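(* Let $\mathcal X$ be a hyperelliptic curve of genus $g\ge 2$ over $\mathbb F_q$ given by an imaginary model $y^2+h(x)y=f(x)$ with unique point at infinity $P_\infty$. Let $A$ be an $\mathbb F_q$-rational divisor on $\mathcal X$ of degree $g-1$, and let $(u_A,v_A)$ be the reduced Mumford representative of the class $[A-(g-1)P_\infty]\in J(\mathcal X)$. Then $A$ is non-special if and only if $\deg u_A=g$.
   Context: $\mathbb F_q$ is a finite field, of any characteristic. $\mathcal X$ is the smooth projective curve of genus $g\ge2$ with affine equation $y^2+h(x)y=f(x)$, where $h,f\in\mathbb F_q[x]$, $f$ is monic of degree $2g+1$, $\deg h\le g$, and the affine curve is nonsingular over $\overline{\mathbb F}_q$; it has a single point at infinity $P_\infty$, which is $\mathbb F_q$-rational. $J(\mathcal X)=\mathrm{Pic}^0(\mathcal X)$ is the group of degree-zero $\mathbb F_q$-rational divisors modulo linear equivalence. A Mumford pair is $(u,v)\in\mathbb F_q[x]^2$ with $u$ monic, $\deg v<\deg u$ ($v=0$ if $u=1$), and $u\mid v^2+hv-f$. It determines the effective affine $\mathbb F_q$-rational divisor $D_{(u,v)}=\sum_{\xi}m_\xi\,(\xi,v(\xi))$, where $\xi$ runs over the roots of $u$ in $\overline{\mathbb F}_q$ and $m_\xi$ is the multiplicity of $\xi$ in $u$; its degree is $\deg u$. The pair is reduced if $\deg u\le g$. Every class in $J(\mathcal X)$ equals $[D_{(u,v)}-(\deg u)P_\infty]$ for a unique reduced Mumford pair $(u,v)$, called the reduced Mumford representative of the class. For a divisor $G$, $\ell(G)=\dim_{\mathbb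 F_q}\mathcal L(G)$ is the dimension of its Riemann-Roch space; $G$ is non-special if $\ell(K-G)=0$, where $K$ is a canonical divisor, equivalently $\ell(G)=\deg G+1-g$. *)

(* Defs.v *)
From HB Require Import structures.
From mathcomp Require Import all_boot all_order all_algebra all_field zify ring.
From mathcomp.multinomials Require Import freeg.

Set Implicit Arguments.
Unset Strict Implicit.
Unset Printing Implicit Defensive.

Import GRing.Theory.
Local Open Scope ring_scope.
Local Open Scope quotient_scope.

(* The model y^2 + h(x) y = f(x); nonsingularity is a separate predicate. *)
Record imaginary_model (L : fieldType) (g : nat) := ImaginaryModel {
  hpol : {poly L};
  fpol : {poly L};
  fpol_monic : fpol \is monic;
  size_fpol : size fpol = g.*2.+2;
  size_hpol : (size hpol <= g.+1)%N
}.

Definition base_change (F L : fieldType) (iota : {rmorphism F -> L}) (g : nat)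
    (C : imaginary_model F g) : imaginary_model L g.
Proof.
apply: (@ImaginaryModel L g (map_poly iota (hpol C)) (map_poly iota (fpol C))).
- by rewrite map_monic fpol_monic.
- by rewrite size_map_poly size_fpol.
- by rewrite size_map_poly size_hpol.
Defined.

Lemma clear_denom (E : fieldType) (x y h f : E) : y != 0 ->
  x * x + h * x * y - f * (y * y) = ((x / y) ^+ 2 + h * x / y - f) * (y * y).
Proof. by move=> y0; field. Qed.

Section FunctionField.
Variables (L : fieldType) (g : nat) (C : imaginary_model L g).
Local Notation ratfun := {fraction {poly L}}.

Local Notation tofrac := (@FracField.tofrac {poly L}).

Definition curve_poly : {poly ratfun} :=
  'X^2 + (tofrac (hpol C)) *: 'X - (tofrac (fpol C))%:P.

Lemma size_curve_poly_tail :
  (size ((tofrac (hpol C)) *: 'X - (tofrac (fpol C))%:P)%R <= 2)%N.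
Proof.
rewrite (leq_trans (size_polyD _ _)) // geq_max size_polyN.
rewrite (leq_trans (size_scale_leq _ _)) ?size_polyX //=.
by rewrite (leq_trans (size_polyC_leq1 _)).
Qed.

Lemma curve_poly_monic : curve_poly \is monic.
Proof.
rewrite monicE /curve_poly -addrA lead_coefDl ?lead_coefXn //.
by rewrite size_polyXn ltnS size_curve_poly_tail.
Qed.

Lemma size_curve_poly : size curve_poly = 3.
Proof.
rewrite /curve_poly -addrA size_polyDl ?size_polyXn //.
by rewrite ltnS size_curve_poly_tail.
Qed.

Lemma ratfunP (r : ratfun) :
  exists a b : {poly L}, b != 0 /\ r = tofrac a / tofrac b.
Proof.
elim/quotW: r => r; exists \n_r, \d_r; split; first exact: denom_ratioP.
have dn0 : tofrac \d_r != 0 by rewrite tofrac_eq0 denom_ratioP.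
apply: (mulIf dn0); rewrite divfK // /tofrac; unlock FracField.tofrac.
rewrite piE; apply/eqP; rewrite piE /= FracField.equivfE /FracField.mulf.
by rewrite !numden_Ratio ?oner_eq0 ?mulr1 ?denom_ratioP // mulrC.
Qed.

Lemma curve_poly_noroot (r : ratfun) : ~~ root curve_poly r.
Proof.
have [a [b [b0 ->]]] := ratfunP r.
have db0 : tofrac b != 0 by rewrite tofrac_eq0.
apply/negP; rewrite /root /curve_poly !hornerE => /eqP E.
have {E} E : a * a + hpol C * a * b = fpol C * (b * b).
  apply/eqP; rewrite -tofrac_eq tofracD !tofracM -subr_eq0.
  apply/eqP; rewrite -(mul0r (tofrac b * tofrac b)) -E /tofrac.
  exact: clear_denom.
have a0 : a != 0.
  apply: contra_eq_neq E => ->; rewrite !(mulr0, mul0r) addr0 eq_sym.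
  by rewrite !mulf_neq0 // monic_neq0 // fpol_monic.
have szb_gt0 : (0 < size b)%N by rewrite size_poly_gt0.
have sza_gt0 : (0 < size a)%N by rewrite size_poly_gt0.
have szr : size (fpol C * (b * b)) = ((size b).*2 + g.*2)%N.
  have f0 : fpol C != 0 by rewrite monic_neq0 ?fpol_monic.
  have bb0 : b * b != 0 by rewrite mulf_neq0.
  rewrite (size_mul f0 bb0) (size_mul b0 b0) size_fpol.
  move: (size b) szb_gt0 => m; lia.
have sza : size (a * a) = (size a).*2.-1 by rewrite size_mul // addnn.
have szh : (size (hpol C * a * b)%R <= g + size a + (size b).-1)%N.
  have := size_polyMleq (hpol C * a) b; have := size_polyMleq (hpol C) a.
  have := size_hpol C; move: (size b) (size a) szb_gt0 sza_gt0 => m n.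
  move: (size (hpol C * a * b)%R) (size (hpol C * a)%R) (size (hpol C)) => p q s; lia.
have [le_ab|lt_ba] := leqP (size a) (g + size b).
  have := size_polyD (a * a) (hpol C * a * b).
  rewrite E szr sza; move: szb_gt0 sza_gt0 szh le_ab.
  move: (size b) (size a) (size (hpol C * a * b)%R) => m n p; lia.
have : size (a * a + hpol C * a * b) = ((size b).*2 + g.*2)%N by rewrite E.
rewrite size_polyDl sza; move: szb_gt0 sza_gt0 szh lt_ba;
  by move: (size b) (size a) (size (hpol C * a * b)%R) => m n p; lia.
Qed.

Lemma curve_poly_irr : monic_irreducible_poly curve_poly.
Proof.
split; last exact: curve_poly_monic.
by apply: cubic_irreducible; [rewrite size_curve_poly | exact: curve_poly_noroot].
Qed.

Definition funfield := {poly %/ curve_poly with curve_poly_irr}.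
HB.instance Definition _ := GRing.Field.on funfield.

Definition of_ratfun (r : ratfun) : funfield := in_qpoly curve_poly r%:P.
Definition fconst (c : L) : funfield := of_ratfun (tofrac c%:P).
Definition fx : funfield := of_ratfun (tofrac 'X).
Definition fy : funfield := in_qpoly curve_poly 'X.

Definition affine_point :=
  {p : L * L | p.2 ^+ 2 + (hpol C).[p.1] * p.2 == (fpol C).[p.1]}.

(* The L-points of the smooth projective curve (all its closed points when L is
   algebraically closed); None is the point at infinity. *)
Definition point := option affine_point.
HB.instance Definition _ := Choice.on point.
Definition pinf : point := None.

(* Jacobian criterion for the affine curve at its L-points. *)
Definition nonsingular : Prop :=
  forall p : affine_point, let: (xi, eta) := val p in
  ~ (2%:R * eta + (hpol C).[xi] = 0 /\
     (hpol C)^`().[xi] * eta - (fpol C)^`().[xi] = 0).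

(* Coordinate functions of an affine chart containing P, and the coordinates of
   P in it.  The chart at infinity is z = 1/x, w = y/x^(g+1), with equation
   w^2 + z^(g+1) h(1/z) w = z^(2g+2) f(1/z); it is nonsingular at its only
   point with z = 0, namely (0, 0). *)
Definition chart (P : point) : (funfield * funfield) * (L * L) :=
  if P is Some p then ((fx, fy), val p)
  else ((fx^-1, fy / fx ^+ g.+1), (0, 0)).

(* Two-variable polynomials: the outer variable is the second coordinate. *)
Definition subst2 (N : {poly {poly L}}) (X Y : funfield) : funfield :=
  (map_poly (fun c : {poly L} => (map_poly fconst c).[X]) N).[Y].

(* phi lies in the local ring at P and takes there the value c. *)
Definition value_at (P : point) (phi : funfield) (c : L) : Prop :=
  let: ((X, Y), (a, b)) := chart P in
  exists N D : {poly {poly L}},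
    [/\ D.[b%:P].[a] != 0,
        phi = subst2 N X Y / subst2 D X Y
      & c = N.[b%:P].[a] / D.[b%:P].[a]].

Definition regular_at (P : point) (phi : funfield) : Prop :=
  exists c, value_at P phi c.

(* t generates the maximal ideal of the local ring at P. *)
Definition uniformizer (P : point) (t : funfield) : Prop :=
  value_at P t 0 /\
  forall s, value_at P s 0 -> exists2 r, regular_at P r & s = t * r.

(* phi is nonzero and ord_P(phi) = n: phi is t^n times a unit. *)
Definition is_ord (P : point) (phi : funfield) (n : int) : Prop :=
  exists t c, [/\ uniformizer P t, c != 0 & value_at P (phi / t ^ n) c].

Definition derivation (d : funfield -> funfield) : Prop :=
  [/\ forall a b, d (a + b) = d a + d b,
      forall a b, d (a * b) = d a * b + a * d b
    & forall c, d (fconst c) = 0].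

(* The differential phi dpsi is nonzero and has order n at P: it equals
   phi (dpsi/dt) dt, where d/dt is the derivation taking t to 1. *)
Definition is_ord_diff (P : point) (phi psi : funfield) (n : int) : Prop :=
  exists t d, [/\ uniformizer P t, derivation d, d t = 1
                & is_ord P (phi * d psi) n].

Definition divisor := {freeg point / int}.

End FunctionField.

Section Rational.
(* K is meant to be an algebraic closure of F, with embedding iota. *)
Variables (F : fieldType) (K : closedFieldType) (iota : {rmorphism F -> K}).
Variables (g : nat) (C : imaginary_model F g).
Local Notation CK := (base_change iota C).
Local Notation FK := (funfield CK).
Local Notation divK := (divisor CK).

(* Invariance under the Galois group of K over F. *)
Definition rational_div (D : divK) : Prop :=
  forall sigma : {rmorphism K -> K}, (forall c, sigma (iota c) = iota c) ->
  forall P Q : affine_point CK,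
    val Q = (sigma (val P).1, sigma (val P).2) ->
  coeff (Some Q : point CK) D = coeff (Some P : point CK) D.

Definition base_poly (p : {poly F}) : FK :=
  of_ratfun CK (tofrac (map_poly iota p)).

(* F(X), as the subfield of K(X) generated by F, x and y. *)
Definition rational_fun (phi : FK) : Prop :=
  exists a b c : {poly F},
    c != 0 /\ phi = (base_poly a + base_poly b * fy CK) / base_poly c.

(* Equality of classes, through an F-rational function. *)
Definition lin_equiv (D1 D2 : divK) : Prop :=
  exists2 phi : FK, rational_fun phi & forall P, is_ord P phi (coeff P (D1 - D2)).

Definition canonical_div (W : divK) : Prop :=
  exists phi psi : FK, [/\ rational_fun phi, rational_fun psi
    & forall P, is_ord_diff P phi psi (coeff P W)].

Definition riemann_roch_space (G : divK) (phi : FK) : Prop :=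
  rational_fun phi /\
  (phi = 0 \/
   forall P, exists2 n : int, is_ord P phi n & (- coeff P G <= n)%R).

(* V is an F-vector space of dimension n. *)
Definition has_dim (V : FK -> Prop) (n : nat) : Prop :=
  exists e : 'I_n -> FK,
    let comb (c : 'rV[F]_n) := \sum_i fconst CK (iota (c 0 i)) * e i in
    (forall phi, V phi <-> exists c, phi = comb c) /\
    (forall c, comb c = 0 -> c = 0).

Definition ell_is (G : divK) (n : nat) : Prop := has_dim (riemann_roch_space G) n.

Definition nonspecial (G : divK) : Prop :=
  exists2 W : divK, canonical_div W & ell_is (W - G) 0.

Definition mumford_pair (u v : {poly F}) : Prop :=
  [/\ u \is monic, (size v < size u)%N
    & u %| v ^+ 2 + hpol C * v - fpol C].

(* For (xi, eta) off the affine curve this is the junk value pinf; it is only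
   used for points of the curve. *)
Definition mkpoint (xi eta : K) : point CK := insub (xi, eta).

Definition mumford_div (u v : {poly F}) : divK :=
  let uK := map_poly iota u in let vK := map_poly iota v in
  \sum_(xi <- undup (sval (closed_field_poly_normal uK)))
     << (mup xi uK)%:Z *g mkpoint xi vK.[xi] >>.

(* (u, v) is the reduced Mumford representative of the class of D. *)
Definition reduced_mumford_rep (u v : {poly F}) (D : divK) : Prop :=
  [/\ mumford_pair u v, ((size u).-1 <= g)%N
    & lin_equiv D (mumford_div u v - << ((size u).-1)%:Z *g pinf CK >>)].

End Rational.

(* Main.v *)
Require Import Defs.
From HB Require Import structures.
From mathcomp Require Import all_boot all_order all_algebra all_field zify ring.
From mathcomp.multinomials Require Import freeg.

(* Let [m = deg u_A], [D = D_(u_A, v_A)], and let [phi0] be a function with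
   divisor [A - (g-1) Pinf - (D - m Pinf)].  The differential [dx / (2y + h)] has
   divisor [(2g-2) Pinf], so division by [phi0] maps [L(K - A)] onto the functions
   [e] with [div e >= D - (g-1+m) Pinf].  Such an [e] is regular on the affine
   curve, hence [e = p(x) + q(x) y]; since [x] and [y] have poles of orders [2] and
   [2g+1] at [Pinf] and [g-1+m <= 2g-1], in fact [q = 0] and [2 deg p <= g-1+m].
   Vanishing on [D] means that [u_A] divides [p], so a nonzero [e] exists if and
   only if [2m <= g-1+m], and then [e = u_A(x)] is one.

   A canonical divisor given by [phi dpsi] is compared with [(2g-2) Pinf] through
   the derivation [delta = (2y + h) d/dx]: [dpsi / dt = delta psi / delta t], and
   [delta t] is a unit at every affine point if [t] is a uniformizer there.  The
   chart at infinity is again of the form [w^2 + H(z) w = G(z)], with its own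
   derivation, which differs from [delta] by the factor [- x^(g-1)]. *)

Set Implicit Arguments.
Unset Strict Implicit.
Unset Printing Implicit Defensive.

Import Order.TTheory GRing.Theory Num.Theory Pdiv.CommonRing.
Local Open Scope ring_scope.

(** * Local rings and derivations of a chart [Y^2 + H(X) Y = G(X)] *)

Section LinearPoly.
Variable R : nzRingType.

Lemma linear_polyE (p : {poly R}) : (size p <= 2)%N -> p = (p`_0)%:P +
  (p`_1)%:P * 'X.
Proof.
move=> sz; apply/polyP => i; rewrite coefD coefC coefMX coefC.
case: i => [|[|i]]; rewrite ?eqxx ?addr0 ?add0r //=.
by rewrite nth_default ?addr0 // (leq_trans sz).
Qed.

Lemma size_linear_poly (r s : R) : (size (r%:P + s%:P * 'X)%R < 3)%N.
Proof.
rewrite (leq_ltn_trans (size_polyD _ _)) // gtn_max.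
rewrite (leq_ltn_trans (size_polyC_leq1 _)) //= mul_polyC.
by rewrite (leq_ltn_trans (size_scale_leq _ _)) ?size_polyX.
Qed.

Lemma linear_poly_eq0 (r s : R) : r%:P + s%:P * 'X = 0 -> r = 0 /\ s = 0.
Proof.
move=> /polyP Ep; have := Ep 0%N; have := Ep 1%N.
by rewrite !(coef0, coefD, coefMX, coefC) /= add0r addr0.
Qed.

End LinearPoly.

(** * Partial derivative of a two-variable polynomial in the inner variable *)

Section PartialDerivative.
Variable R : comNzRingType.

Lemma map_deriv_polyM (N M : {poly {poly R}}) :
  map_poly deriv (N * M) = map_poly deriv N * M + N * map_poly deriv M.
Proof.
apply/polyP => i; rewrite coefD coef_map_id0 ?deriv0 // !coefM raddf_sum.
rewrite -big_split; apply: eq_bigr => j _ /=.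
by rewrite !coef_map_id0 ?deriv0 // derivM.
Qed.

Lemma map_deriv_polyD (N M : {poly {poly R}}) :
  map_poly deriv (N + M) = map_poly deriv N + map_poly deriv M.
Proof. by apply/polyP => i; rewrite !(coefD, coef_map_id0, deriv0, derivD). Qed.

Lemma map_deriv_polyC (p : {poly R}) : map_poly deriv p%:P = p^`()%:P.
Proof.
by apply/polyP => i; rewrite coef_map_id0 ?deriv0 // !coefC; case: i => // i;
  rewrite deriv0.
Qed.

Lemma map_deriv_polyX : map_poly deriv 'X = 0 :> {poly {poly R}}.
Proof.
by apply/polyP => i; rewrite coef_map_id0 ?deriv0 // coefX coef0 -(rmorph_nat
  (@polyC R)) derivC.
Qed.

End PartialDerivative.

Section Chart.
Variables (K E : fieldType) (iota : {rmorphism K -> E}) (X Y : E).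
Variables (H G : {poly K}).

Definition ev (p : {poly K}) : E := (map_poly iota p).[X].
Definition ev2 (N : {poly {poly K}}) : E := (map_poly ev N).[Y].
Definition at_point (a b : K) (N : {poly {poly K}}) : K := N.[b%:P].[a].

Let ev_morph := [the {rmorphism {poly K} -> E} of horner_eval X \o map_poly
  iota].

Lemma evD : {morph ev : p q / p + q}. Proof. exact: (rmorphD ev_morph). Qed.
Lemma evN : {morph ev : p / - p}. Proof. exact: (rmorphN ev_morph). Qed.
Lemma evB : {morph ev : p q / p - q}. Proof. exact: (rmorphB ev_morph). Qed.
Lemma evM : {morph ev : p q / p * q}. Proof. exact: (rmorphM ev_morph). Qed.
Lemma ev0 : ev 0 = 0. Proof. exact: (rmorph0 ev_morph). Qed.
Lemma ev1 : ev 1 = 1. Proof. exact: (rmorph1 ev_morph). Qed.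
Lemma evC c : ev c%:P = iota c. Proof. by rewrite /ev map_polyC hornerC. Qed.
Lemma evX : ev 'X = X. Proof. by rewrite /ev map_polyX hornerX. Qed.
Lemma evXn p n : ev (p ^+ n) = ev p ^+ n. Proof. exact: (rmorphXn ev_morph).
  Qed.

HB.instance Definition _ :=
  GRing.isZmodMorphism.Build {poly K} E ev evB.
HB.instance Definition _ :=
  GRing.isMonoidMorphism.Build {poly K} E ev (ev1, evM).

Let ev2_morph := [the {rmorphism {poly {poly K}} -> E} of horner_eval Y \o
  map_poly ev].

Lemma ev2D : {morph ev2 : p q / p + q}. Proof. exact: (rmorphD ev2_morph). Qed.
Lemma ev2N : {morph ev2 : p / - p}. Proof. exact: (rmorphN ev2_morph). Qed.
Lemma ev2B : {morph ev2 : p q / p - q}. Proof. exact: (rmorphB ev2_morph). Qed.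
Lemma ev2M : {morph ev2 : p q / p * q}. Proof. exact: (rmorphM ev2_morph). Qed.
Lemma ev20 : ev2 0 = 0. Proof. exact: (rmorph0 ev2_morph). Qed.
Lemma ev21 : ev2 1 = 1. Proof. exact: (rmorph1 ev2_morph). Qed.
Lemma ev2C p : ev2 p%:P = ev p. Proof. by rewrite /ev2 map_polyC hornerC. Qed.
Lemma ev2X : ev2 'X = Y. Proof. by rewrite /ev2 map_polyX hornerX. Qed.

Let at_morph a b := [the {rmorphism {poly {poly K}} -> K} of
  horner_eval a \o horner_eval b%:P].

Lemma atD a b : {morph at_point a b : p q / p + q}.
Proof. exact: (rmorphD (at_morph a b)). Qed.
Lemma atN a b : {morph at_point a b : p / - p}.
Proof. exact: (rmorphN (at_morph a b)). Qed.
Lemma atM a b : {morph at_point a b : p q / p * q}.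
Proof. exact: (rmorphM (at_morph a b)). Qed.
Lemma at1 a b : at_point a b 1 = 1. Proof. exact: (rmorph1 (at_morph a b)). Qed.
Lemma atC a b p : at_point a b p%:P = p.[a]. Proof. by rewrite /at_point
  hornerC. Qed.
Lemma atX a b : at_point a b 'X = b. Proof. by rewrite /at_point hornerX
  hornerC. Qed.

Hypothesis XY_curve : Y ^+ 2 + ev H * Y = ev G.
Hypothesis XY_free : forall p q, ev p + ev q * Y = 0 -> p = 0 /\ q = 0.
Hypothesis XY_gen :
  forall e, exists p q r, ev r != 0 /\ e = (ev p + ev q * Y) / ev r.

Lemma ev_eq0 p : (ev p == 0) = (p == 0).
Proof.
apply/eqP/eqP => [p0|->]; last exact: ev0.
by case: (@XY_free p 0); rewrite // ev0 mul0r addr0.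
Qed.

Definition curve2 : {poly {poly K}} := 'X^2 + H%:P * 'X - G%:P.

Lemma ev2_curve : ev2 curve2 = 0.
Proof.
by rewrite /curve2 expr2 ev2B ev2D !ev2M !ev2C ev2X -XY_curve -expr2 subrr.
Qed.

Lemma size_curve2_tail : (size (H%:P * 'X - G%:P)%R <= 2)%N.
Proof.
rewrite (leq_trans (size_polyD _ _)) // geq_max size_polyN.
rewrite mul_polyC (leq_trans (size_scale_leq _ _)) ?size_polyX //=.
by rewrite (leq_trans (size_polyC_leq1 _)).
Qed.

Lemma curve2_monic : curve2 \is monic.
Proof.
rewrite monicE /curve2 -addrA lead_coefDl ?lead_coefXn //.
by rewrite size_polyXn ltnS size_curve2_tail.
Qed.

Lemma size_curve2 : size curve2 = 3.
Proof.
rewrite /curve2 -addrA size_polyDl ?size_polyXn //.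
by rewrite ltnS size_curve2_tail.
Qed.

(** [curve2] is monic in the outer variable, so division by it with remainder works over the ring
    [{poly K}]. *)
Lemma mod_curve2 N : exists M p q, N = M * curve2 + (p%:P + q%:P * 'X).
Proof.
exists (rdivp N curve2), (rmodp N curve2)`_0, (rmodp N curve2)`_1.
rewrite {1}(Pdiv.RingMonic.rdivp_eq curve2_monic N); congr (_ + _).
have sz : (size (rmodp N curve2) <= 2)%N.
  by have := @ltn_rmodpN0 _ N _ (monic_neq0 curve2_monic); rewrite size_curve2.
exact: linear_polyE.
Qed.

(** [XY_free] kills the remainder modulo [curve2]; so the coordinate ring of the chart embeds in
    [E]. *)
Lemma ev2_ker N : ev2 N = 0 -> exists M, N = M * curve2.
Proof.
have [M [p [q ->]]] := mod_curve2 N.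
rewrite ev2D ev2M ev2_curve mulr0 add0r ev2D ev2M !ev2C ev2X.
by case/XY_free => -> ->; exists M; rewrite !polyC0 mul0r !addr0.
Qed.

Lemma ev2_normal N : exists p q, ev2 N = ev p + ev q * Y.
Proof.
have [M [p [q ->]]] := mod_curve2 N; exists p, q.
by rewrite ev2D ev2M ev2_curve mulr0 add0r ev2D ev2M !ev2C ev2X.
Qed.

(* The derivation [(2Y + H(X)) d/dX] maps [K[X, Y]] to itself and preserves the
   curve equation; it is dual to the differential [dX / (2Y + H(X))]. *)
Definition dpoly (N : {poly {poly K}}) : {poly {poly K}} :=
  map_poly deriv N * ('X *+ 2 + H%:P) + N^`() * (G^`()%:P - H^`()%:P * 'X).

Lemma dpolyD N M : dpoly (N + M) = dpoly N + dpoly M.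
Proof. by rewrite /dpoly map_deriv_polyD derivD !mulrDl addrACA. Qed.

Lemma dpolyM N M : dpoly (N * M) = dpoly N * M + N * dpoly M.
Proof. by rewrite /dpoly map_deriv_polyM derivM; ring. Qed.

Lemma dpolyC p : dpoly p%:P = p^`()%:P * ('X *+ 2 + H%:P).
Proof. by rewrite /dpoly map_deriv_polyC derivC mul0r addr0. Qed.

Lemma dpolyX : dpoly 'X = G^`()%:P - H^`()%:P * 'X.
Proof. by rewrite /dpoly map_deriv_polyX derivX mul0r add0r mul1r. Qed.

Lemma dpolyN N : dpoly (- N) = - dpoly N.
Proof.
apply: (@addrI _ (dpoly N)); rewrite -dpolyD !subrr.
by rewrite -(polyC0) dpolyC deriv0 mul0r.
Qed.

Lemma dpoly_curve2 : dpoly curve2 = 0.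
Proof.
by rewrite /curve2 expr2 !dpolyD !dpolyM dpolyN !dpolyC dpolyX; ring.
Qed.

Lemma ev2_dpolyD N M : ev2 (dpoly (N + M)) = ev2 (dpoly N) + ev2 (dpoly M).
Proof. by rewrite dpolyD (ev2D (dpoly N)). Qed.

Lemma ev2_dpolyM N M :
  ev2 (dpoly (N * M)) = ev2 (dpoly N) * ev2 M + ev2 N * ev2 (dpoly M).
Proof. by rewrite dpolyM (ev2D (dpoly N * M)) (ev2M (dpoly N)) (ev2M N). Qed.

(** [dpoly] kills [curve2], hence preserves the ideal it generates and descends to the coordinate
    ring. *)
Lemma ev2_dpoly_ker N : ev2 N = 0 -> ev2 (dpoly N) = 0.
Proof.
case/ev2_ker => M ->.
by rewrite dpolyM dpoly_curve2 mulr0 addr0 ev2M ev2_curve mulr0.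
Qed.

Lemma ev2_dpoly_eq N M : ev2 N = ev2 M -> ev2 (dpoly N) = ev2 (dpoly M).
Proof.
move=> NM; apply/eqP; rewrite -subr_eq0 -ev2B -dpolyN -dpolyD.
by rewrite ev2_dpoly_ker // ev2B NM subrr.
Qed.

Lemma ev2_frac e : exists ND : {poly {poly K}} * {poly {poly K}},
  (ev2 ND.2 != 0) && (e == ev2 ND.1 / ev2 ND.2).
Proof.
have [p [q [r [r0 ->]]]] := XY_gen e.
by exists (p%:P + q%:P * 'X, r%:P); rewrite /= ev2D ev2M !ev2C ev2X r0 eqxx.
Qed.

(** The quotient rule on a fraction picked by [xchoose]; by [deltaE] the choice does not matter. *)
Definition delta (e : E) : E :=
  let: (N, D) := xchoose (ev2_frac e) in
  (ev2 (dpoly N) * ev2 D - ev2 N * ev2 (dpoly D)) / ev2 D ^+ 2.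

Lemma deltaE N D : ev2 D != 0 -> delta (ev2 N / ev2 D) =
  (ev2 (dpoly N) * ev2 D - ev2 N * ev2 (dpoly D)) / ev2 D ^+ 2.
Proof.
rewrite /delta; case: (xchoose _) (xchooseP (ev2_frac (ev2 N / ev2 D))).
move=> N' D' /= /andP[D'0 /eqP E1] D0.
have E2 : ev2 (N * D') = ev2 (N' * D).
  by apply/eqP; rewrite !ev2M -eqr_div // E1.
(* Differentiating the cross-multiplied relation determines [ev2 (dpoly N')]. *)
have E3 := ev2_dpoly_eq E2; rewrite !ev2_dpolyM in E3.
have N'E : ev2 N' = ev2 N * ev2 D' / ev2 D.
  by apply: (canRL (mulfK D0)); rewrite -!ev2M E2.
have dN' : ev2 (dpoly N') = (ev2 (dpoly N) * ev2 D' + ev2 N * ev2 (dpoly D') -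
    ev2 N' * ev2 (dpoly D)) / ev2 D.
  by apply: (canRL (mulfK D0)); rewrite E3 addrK.
by rewrite dN' N'E; field; rewrite D0 D'0.
Qed.

Lemma delta_ev2 N : delta (ev2 N) = ev2 (dpoly N).
Proof.
have := @deltaE N 1; rewrite ev21 !divr1 => ->; last exact: oner_neq0.
by rewrite -(polyC1) dpolyC derivC mul0r ev20 mulr0 subr0 mulr1 expr1n divr1.
Qed.

Lemma deltaD e1 e2 : delta (e1 + e2) = delta e1 + delta e2.
Proof.
have [[N1 D1] /= /andP[D10 /eqP->]] := ev2_frac e1.
have [[N2 D2] /= /andP[D20 /eqP->]] := ev2_frac e2.
have -> : ev2 N1 / ev2 D1 + ev2 N2 / ev2 D2 =
    ev2 (N1 * D2 + N2 * D1) / ev2 (D1 * D2).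
  by rewrite ev2D !ev2M; field; rewrite D10 D20.
rewrite !deltaE ?(ev2M D1) ?mulf_neq0 // ev2_dpolyD !ev2_dpolyM (ev2D (N1 *
  D2)) !ev2M.
by field; rewrite D10 D20.
Qed.

Lemma deltaM e1 e2 : delta (e1 * e2) = delta e1 * e2 + e1 * delta e2.
Proof.
have [[N1 D1] /= /andP[D10 /eqP->]] := ev2_frac e1.
have [[N2 D2] /= /andP[D20 /eqP->]] := ev2_frac e2.
have -> : ev2 N1 / ev2 D1 * (ev2 N2 / ev2 D2) =
    ev2 (N1 * N2) / ev2 (D1 * D2).
  by rewrite !ev2M; field; rewrite D10 D20.
rewrite !deltaE ?(ev2M D1) ?mulf_neq0 // !ev2_dpolyM !ev2M.
by field; rewrite D10 D20.
Qed.

Lemma delta_ev p : delta (ev p) = ev p^`() * (Y *+ 2 + ev H).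
Proof.
by rewrite -ev2C delta_ev2 dpolyC ev2M ev2D !ev2C mulr2n ev2D ev2X -mulr2n.
Qed.

Lemma delta_iota c : delta (iota c) = 0.
Proof. by rewrite -evC delta_ev derivC ev0 mul0r. Qed.

Lemma deltaX : delta X = Y *+ 2 + ev H.
Proof. by rewrite -{1}evX delta_ev derivX ev1 mul1r. Qed.

Lemma deltaY : delta Y = ev G^`() - ev H^`() * Y.
Proof. by rewrite -{1}ev2X delta_ev2 dpolyX ev2B ev2M !ev2C ev2X. Qed.

(* The derivations of [E] over [K] form a one-dimensional space. *)
Lemma derivation_delta (d : E -> E) :
    (forall a b, d (a + b) = d a + d b) ->
    (forall a b, d (a * b) = d a * b + a * d b) ->
    (forall c, d (iota c) = 0) ->
  forall e, d e * delta X = d X * delta e.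
Proof.
move=> dD dM dC.
have dev p : d (ev p) = ev p^`() * d X.
  elim/poly_ind: p => [|p c IH]; first by have := dC 0;
    rewrite deriv0 !ev0 mul0r rmorph0.
  rewrite derivMXaddC !evD !evM evX evC dD dM IH dC; ring.
(* Applying [d] to the curve equation gives [(2Y + H) dY = (G' - H' Y) dX]. *)
have dYE : d Y * delta X = d X * delta Y.
  have := congr1 d XY_curve; rewrite expr2 dD !dM !dev => E1.
  rewrite deltaX deltaY mulrBr.
  have -> : d X * ev G^`() = ev G^`() * d X by rewrite mulrC.
  by rewrite -E1; ring.
have dev2 N : d (ev2 N) * delta X = d X * delta (ev2 N).
  elim/poly_ind: N => [|N c IH].
    by have := dC 0; have := delta_iota 0; rewrite ev20 rmorph0 => -> ->;
      rewrite mul0r mulr0.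
  rewrite ev2D ev2M ev2X ev2C dD dM dev deltaD deltaM delta_ev -deltaX.
  rewrite !mulrDl !mulrDr [_ * Y * _]mulrAC IH -[ev2 N * d Y * _]mulrA dYE.
  ring.
(* Both derivations applied to [e * ev2 D = ev2 N] extend the identity from polynomials to
   fractions. *)
move=> e; have [[N D] /= /andP[D0 /eqP Ee]] := ev2_frac e.
have eD : e * ev2 D = ev2 N by rewrite Ee divfK.
have := congr1 d eD; have := congr1 delta eD; rewrite dM deltaM => E1 E2.
apply: (mulIf D0).
have -> : d e * delta X * ev2 D = (d e * ev2 D + e * d (ev2 D)) * delta X
   - e * (d (ev2 D) * delta X) by ring.
rewrite E2 dev2 dev2 -E1; ring.
Qed.

(** * The local ring at a point of the chart *)

Section Point.
Variables a b : K.
Hypothesis ab_curve : b ^+ 2 + H.[a] * b = G.[a].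

(** This is [value_at] for arbitrary coordinates, so that the affine chart and the chart at infinity
    share one theory. *)
Definition vat (e : E) (c : K) := exists N D : {poly {poly K}},
  [/\ at_point a b D != 0, e = ev2 N / ev2 D & c = at_point a b N / at_point a
    b D].

(** Such an [N] is a multiple of [curve2], which vanishes at [(a, b)]; this makes values well
    defined. *)
Lemma at_ker N : ev2 N = 0 -> at_point a b N = 0.
Proof.
case/ev2_ker => M ->; rewrite atM /curve2 !atD atN expr2 !atM !atC atX -expr2.
by rewrite ab_curve subrr mulr0.
Qed.

Lemma ev2_neq0 N : at_point a b N != 0 -> ev2 N != 0.
Proof. by apply: contra_neq => /at_ker. Qed.

Lemma vat_uniq e c c' : vat e c -> vat e c' -> c = c'.
Proof.
move=> [N [D [D0 -> ->]]] [N' [D' [D'0 E1 ->]]].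
have /at_ker : ev2 (N * D' - N' * D) = 0.
  apply/eqP; rewrite ev2B !ev2M subr_eq0.
  by rewrite -eqr_div ?ev2_neq0 // E1.
by move/eqP; rewrite atD atN !atM subr_eq0 -eqr_div // => /eqP.
Qed.

Lemma vat_ev2 N : vat (ev2 N) (at_point a b N).
Proof. by exists N, 1; rewrite at1 ev21 !divr1 oner_neq0. Qed.

Lemma vat_ev p : vat (ev p) p.[a].
Proof. by have := vat_ev2 p%:P; rewrite ev2C atC. Qed.

Lemma vat_iota c : vat (iota c) c.
Proof. by have := vat_ev c%:P; rewrite evC hornerC. Qed.

Lemma vatX : vat X a.
Proof. by have := vat_ev 'X; rewrite evX hornerX. Qed.

Lemma vatY : vat Y b.
Proof. by have := vat_ev2 'X; rewrite ev2X atX. Qed.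

Lemma vatD e e' c c' : vat e c -> vat e' c' -> vat (e + e') (c + c').
Proof.
move=> [N [D [D0 -> ->]]] [N' [D' [D'0 -> ->]]].
exists (N * D' + N' * D), (D * D'); rewrite !(ev2D, ev2M, atD, atM) mulf_neq0
  //.
by split => //; rewrite addf_div ?ev2_neq0.
Qed.

Lemma vatM e e' c c' : vat e c -> vat e' c' -> vat (e * e') (c * c').
Proof.
move=> [N [D [D0 -> ->]]] [N' [D' [D'0 -> ->]]].
exists (N * N'), (D * D'); rewrite !(ev2M, atM) mulf_neq0 //.
by split => //; rewrite mulf_div.
Qed.

Lemma vatV e c : c != 0 -> vat e c -> vat e^-1 c^-1.
Proof.
move=> c0 [N [D [D0 -> cE]]]; move: c0; rewrite cE mulf_eq0 negb_or => /andP[N0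
  _].
by exists D, N; rewrite !invf_div.
Qed.

(** The quotient rule has denominator [D ^+ 2], which does not vanish at the point: [delta]
    preserves the local ring. *)
Lemma vat_delta e c : vat e c -> exists c', vat (delta e) c'.
Proof.
move=> [N [D [D0 -> _]]]; rewrite deltaE ?ev2_neq0 //.
exists (at_point a b (dpoly N * D - N * dpoly D) / at_point a b (D ^+ 2)).
exists (dpoly N * D - N * dpoly D), (D ^+ 2).
by rewrite !expr2 atM mulf_neq0 // ev2B !ev2M.
Qed.

Hypothesis ab_nonsing : ~ (2%:R * b + H.[a] = 0 /\ H^`().[a] * b - G^`().[a] =
  0).

(** [2b + H(a)] is the partial derivative of the equation in [Y]. If it is nonzero, [X - a] is a
    uniformizer; otherwise [Y - b] is one, by nonsingularity. *)
Definition param : E := if 2%:R * b + H.[a] == 0 then Y - iota b else X - iota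
  a.

Lemma vatB e e' c c' : vat e c -> vat e' c' -> vat (e - e') (c - c').
Proof.
move=> Ve Ve'; have := vatD Ve (vatM (vat_iota (-1)) Ve').
by rewrite rmorphN1 !mulN1r.
Qed.

Lemma param_vat : vat param 0.
Proof.
rewrite /param -(subrr a); case: ifP => _; last exact: vatB vatX (vat_iota a).
by rewrite subrr -(subrr b); exact: vatB vatY (vat_iota b).
Qed.

(** The left-hand side equals [q = G - b^2 - H b], a polynomial in [X] that vanishes at [a]; [k(a)]
    is the derivative of [q] at [a]. *)
Lemma chart_factor : exists k : {poly K},
  [/\ (Y - iota b) * (Y + iota b + ev H) = (X - iota a) * ev k
    & k.[a] = G^`().[a] - H^`().[a] * b].
Proof.
pose q := G - (b ^+ 2)%:P - H * b%:P.
have : root q a by rewrite /root !hornerE -ab_curve; apply/eqP; ring.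
case/factor_theorem => k qE; exists k; split.
  transitivity (ev q); last by rewrite qE evM evB evX evC mulrC.
  by rewrite /q !evB evM !evC -XY_curve rmorphXn; ring.
have := congr1 (fun r : {poly K} => r^`().[a]) qE.
rewrite /q derivM derivXsubC !derivB derivM !derivC !hornerE subrr.
by rewrite ?(mulr0, addr0, add0r, subr0, mulr1) => <-.
Qed.

(* At a ramification point [X - a] has order two. *)
Lemma chart_ramified : 2%:R * b + H.[a] = 0 ->
  exists e c, [/\ vat e c, c != 0 & X - iota a = (Y - iota b) ^+ 2 * e].
Proof.
move=> ram; have [k [kE ka]] := chart_factor.
have k0 : k.[a] != 0.
  by apply/eqP => k0; apply: ab_nonsing; split; rewrite // -opprB -ka k0 oppr0.
have evk0 : ev k != 0 by rewrite -ev2C ev2_neq0 // atC.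
(* As [H = H1 (X - a) - 2b], the factor [Y + b + H] is [(Y - b) + H1 (X - a)]. Since [X - a] is
   itself a multiple of [Y - b], a second factor [Y - b] splits off. *)
have : root ((2%:R * b)%:P + H) a by rewrite /root !hornerE ram.
case/factor_theorem => H1 H1E.
have {}H1E : ev H = ev H1 * (X - iota a) - 2%:R * iota b.
  have := congr1 ev H1E; rewrite evD evM evB evX !evC rmorphM rmorph_nat => <-.
  by rewrite addrAC subrr add0r.
have XaE : X - iota a = (Y - iota b) * (Y + iota b + ev H) / ev k.
  by rewrite kE mulfK.
have V1 : vat (Y + iota b + ev H) 0.
  have := vatD (vatD vatY (vat_iota b)) (vat_ev H).
  by rewrite -mulr2n -mulr_natl ram.
exists ((1 + ev H1 * ((Y + iota b + ev H) / ev k)) / ev k), (1 / k.[a]).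
split.
- have V2 := vatV k0 (vat_ev k).
  have := vatM (vatD (vat_iota 1) (vatM (vat_ev H1) (vatM V1 V2))) V2.
  by rewrite rmorph1 mul0r mulr0 addr0.
- by rewrite mul1r invr_eq0.
have E1 : Y + iota b + ev H =
    (Y - iota b) * (1 + ev H1 * ((Y + iota b + ev H) / ev k)).
  rewrite {1}H1E XaE; ring.
by rewrite {1}XaE {1}E1; ring.
Qed.

(** Here [Y + b + H] has the nonzero value [2b + H(a)], so it can be divided out of
    [chart_factor]. *)
Lemma chart_unramified : 2%:R * b + H.[a] != 0 ->
  exists e c, vat e c /\ Y - iota b = (X - iota a) * e.
Proof.
move=> unr; have [k [kE _]] := chart_factor.
have V1 : vat (Y + iota b + ev H) (2%:R * b + H.[a]).
  by rewrite mulr_natl mulr2n; exact: vatD (vatD vatY (vat_iota b)) (vat_ev H).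
have nz : Y + iota b + ev H != 0.
  apply: contra_neq unr => E0; rewrite E0 in V1.
  by apply: (vat_uniq V1); have := vat_iota 0; rewrite rmorph0.
exists (ev k / (Y + iota b + ev H)), (k.[a] / (2%:R * b + H.[a])); split.
  exact: vatM (vat_ev k) (vatV unr V1).
by rewrite mulrA -kE mulfK.
Qed.

Lemma param_dvd_coord :
  (exists e c, vat e c /\ X - iota a = param * e) /\
  (exists e c, vat e c /\ Y - iota b = param * e).
Proof.
rewrite /param; case: eqP => [ram|/eqP unr].
  split; last by exists 1, 1; rewrite mulr1 -(rmorph1 iota); split => //;
    apply: vat_iota.
  have [e [c [Ve c0 ->]]] := chart_ramified ram.
  exists ((Y - iota b) * e), (0 * c); rewrite mulrA -expr2; split => //.
  by apply: vatM Ve; rewrite -(subrr b); exact: vatB vatY (vat_iota b).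
split; last exact: chart_unramified.
by exists 1, 1; rewrite mulr1 -(rmorph1 iota); split => //; apply: vat_iota.
Qed.

(** Dividing the numerator by [Y - b], then the remainder by [X - a], writes it as a combination of
    these two differences, both multiples of [param]. *)
Lemma param_dvd s : vat s 0 -> exists e c, vat e c /\ s = param * e.
Proof.
move=> [N [D [D0 -> /esym/eqP]]]; rewrite mulf_eq0 invr_eq0 (negbTE D0) orbF =>
  /eqP N0.
have [N1 NE] : exists N1, N = N1 * ('X - b%:P%:P) + N.[b%:P]%:P.
  have : root (N - N.[b%:P]%:P) b%:P by rewrite /root !hornerE subrr.
  by case/factor_theorem => N1 N1E; exists N1; rewrite -N1E subrK.
have : root N.[b%:P] a by apply/eqP.
case/factor_theorem => N2 N2E; rewrite {}N2E in NE.
have [[e1 [c1 [V1 X1]]] [e2 [c2 [V2 Y1]]]] := param_dvd_coord.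
have VD := vatV D0 (vat_ev2 D).
have V := vatM (vatD (vatM (vat_ev2 N1) V2) (vatM (vat_ev N2) V1)) VD.
eexists; eexists; split; first exact: V.
rewrite {1}NE !(ev2D, ev2M, ev2B, ev2C, ev2N, evB, evC, evM, evX) ev2X X1 Y1;
  ring.
Qed.

(* The norm [(p + qY)(p - qH - qY)] lies in [K[X]]. *)
Lemma ev2_norm N : ev2 N != 0 -> exists M r, r != 0 /\ ev2 N * ev2 M = ev r.
Proof.
have [p [q ->]] := ev2_normal N => nz.
exists (p%:P - q%:P * H%:P - q%:P * 'X), (p ^+ 2 - p * q * H - q ^+ 2 * G).
have E1 : (ev p + ev q * Y) * ev2 (p%:P - q%:P * H%:P - q%:P * 'X) =
    ev (p ^+ 2 - p * q * H - q ^+ 2 * G).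
  rewrite !(ev2B, ev2M, ev2C, ev2X, evB, evM, evXn) -XY_curve.
  ring.
split=> //; rewrite -ev_eq0 -E1 mulf_neq0 //.
have -> : ev2 (p%:P - q%:P * H%:P - q%:P * 'X) = ev (p - q * H) + ev (- q) * Y.
  by rewrite !(ev2B, ev2M, ev2C, ev2X) evB evM evN mulNr.
apply: contra_neq nz => /XY_free[p0 /eqP q0].
by move: p0; rewrite oppr_eq0 in q0; rewrite (eqP q0) mul0r subr0 => ->;
  rewrite ev0 mul0r addr0.
Qed.

Lemma XaE_param : exists k e c, [/\ vat e c, c != 0 & X - iota a = param ^+ k *
  e].
Proof.
rewrite /param; case: eqP => [ram|_].
  by have [e [c [V c0 E1]]] := chart_ramified ram; exists 2%N, e, c.
by exists 1%N, 1, 1; rewrite mulr1 -(rmorph1 iota) oner_neq0; split => //;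
  apply: vat_iota.
Qed.

Lemma ev_param r : r != 0 ->
  exists k e c, [/\ vat e c, c != 0 & ev r = param ^+ k * e].
Proof.
move=> r0; have [n [r1 r1a ->]] := multiplicity_XsubC r a.
rewrite r0 /= in r1a.
have [k [e [c [V c0 XE]]]] := XaE_param.
exists (k * n)%N, (ev r1 * e ^+ n), (r1.[a] * c ^+ n); split.
- apply: vatM; first exact: vat_ev.
  elim: n => [|n IH]; first by rewrite !expr0 -(rmorph1 iota); apply: vat_iota.
  by rewrite !exprS; apply: vatM.
- by rewrite mulf_neq0 ?expf_neq0.
by rewrite evM evXn evB evX evC XE exprMn -exprM mulrCA.
Qed.

Lemma param_neq0 : param != 0.
Proof.
rewrite /param; case: ifP => _; apply/eqP.
  move=> E0; have [] := @XY_free (- b%:P) 1.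
    by rewrite ev1 mul1r evN evC addrC.
  by move=> _ /eqP; rewrite oner_eq0.
move=> E0; have := ev_eq0 ('X - a%:P).
by rewrite evB evX evC E0 eqxx polyXsubC_eq0.
Qed.

(** By [ev2_norm], [ev2 N] divides some [ev r], which is [param ^+ k] times a unit. Induction on
    [k]: either [ev2 N] has a nonzero value, or [param_dvd] splits off a factor [param], to be
    cancelled on both sides. *)
Lemma ev2_param N : ev2 N != 0 ->
  exists k e c, [/\ vat e c, c != 0 & ev2 N = param ^+ k * e].
Proof.
case/ev2_norm => M [r [r0 NM]]; have [k [e [c [V c0 rE]]]] := ev_param r0.
have VM := vat_ev2 M; move: NM; rewrite {}rE.
move: (ev2 M) (at_point a b M) VM => m mc VM.
move: (ev2 N) (at_point a b N) (vat_ev2 N) => s cs.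
elim: k s cs => [|k IH] s cs Vs NM.
  exists 0%N, s, cs; rewrite expr0 mul1r; split=> //.
  apply: contra_neq c0 => cs0; rewrite cs0 in Vs.
  by apply: (vat_uniq V); rewrite -[e]mul1r -(expr0 param) -NM -(mul0r mc);
    apply: vatM.
have [cs0|cs0] := eqVneq cs 0; last by exists 0%N, s, cs; rewrite expr0 mul1r.
rewrite cs0 in Vs; have [s1 [c1 [V1 sE]]] := param_dvd Vs.
have [||k1 [e1 [c1' [V1' c1'0 s1E]]]] := IH s1 c1; first exact: V1.
  by apply: (mulfI param_neq0); rewrite mulrA -sE NM exprS mulrA.
by exists k1.+1, e1, c1'; rewrite sE s1E exprS mulrA.
Qed.

Lemma param_expand e : e != 0 ->
  exists (n : int) c, c != 0 /\ vat (e / param ^ n) c.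
Proof.
have [[N D] /= /andP[D0 /eqP ->]] := ev2_frac e.
rewrite mulf_eq0 invr_eq0 (negPf D0) orbF => N0.
have [k [e1 [c1 [V1 c10 ->]]]] := ev2_param N0.
have [l [e2 [c2 [V2 c20 ->]]]] := ev2_param D0.
exists (k%:Z - l%:Z), (c1 / c2); split; first by rewrite mulf_neq0 ?invr_eq0.
have -> : param ^+ k * e1 / (param ^+ l * e2) / param ^ (k%:Z - l%:Z) = e1 / e2.
  rewrite expfzDr ?param_neq0 // -exprnN -!exprnP.
  have p0 m : param ^+ m != 0 by rewrite expf_neq0 ?param_neq0.
  have e20 : e2 != 0.
    apply: contra_neq c20 => E0; rewrite E0 in V2.
    by apply: (vat_uniq V2); have := vat_iota 0; rewrite rmorph0.
  by field; rewrite !p0 e20.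
exact: vatM V1 (vatV c20 V2).
Qed.

(** The value is, up to sign, one of the two partial derivatives of the equation, and [param] is
    chosen so that this one is nonzero. *)
Lemma delta_param : exists c, c != 0 /\ vat (delta param) c.
Proof.
rewrite /param; case: eqP => [ram|/eqP unr].
  exists (G^`().[a] - H^`().[a] * b); split.
    by apply/eqP => E0; apply: ab_nonsing; split; rewrite // -opprB E0 oppr0.
  rewrite -[- iota b](rmorphN iota) deltaD delta_iota addr0 deltaY.
  exact: vatB (vat_ev _) (vatM (vat_ev _) vatY).
exists (2%:R * b + H.[a]); split => //.
rewrite -[- iota a](rmorphN iota) deltaD delta_iota addr0 deltaX.
by rewrite mulr_natl !mulr2n; apply: vatD (vat_ev H); apply: vatD vatY vatY.
Qed.

End Point.
End Chart.

(** * Discrete valuations *)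

Section Valuation.
Variables (K E : fieldType) (V : E -> K -> Prop).

(** [unif] and [vord] are convertible with [uniformizer P] and [is_ord P] when [V] is
    [value_at P]. *)
Definition unif (t : E) := V t 0 /\
  forall s, V s 0 -> exists2 r, (exists c, V r c) & s = t * r.

Definition vord (e : E) (n : int) :=
  exists t c, [/\ unif t, c != 0 & V (e / t ^ n) c].

(* [V e c] means that [e] lies in a discrete valuation ring of [E] with residue
   field [K] and has residue [c]; [t0] is a uniformizer. *)
Record valued (t0 : E) : Prop := Valued {
  valued_uniq : forall e c c', V e c -> V e c' -> c = c';
  valued_1 : V 1 1;
  valued_N1 : V (-1) (-1);
  valuedD : forall e e' c c', V e c -> V e' c' -> V (e + e') (c + c');
  valuedM : forall e e' c c', V e c -> V e' c' -> V (e * e') (c * c');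
  valuedV : forall e c, c != 0 -> V e c -> V e^-1 c^-1;
  valued_param_neq0 : t0 != 0;
  valued_param : V t0 0;
  valued_dvd : forall s, V s 0 -> exists e c, V e c /\ s = t0 * e;
  valued_expand : forall e, e != 0 -> exists (n : int) c, c != 0 /\ V (e / t0 ^
    n) c
}.

Variable t0 : E.
Hypothesis hV : valued t0.

Lemma unif_param : unif t0.
Proof.
split; first exact: valued_param hV.
by move=> s /(valued_dvd hV)[e [c [Ve ->]]]; exists e => //; exists c.
Qed.

Lemma valued_0 : V 0 0.
Proof.
by rewrite -{1}(subrr 1) -(subrr 1); exact: valuedD hV _ _ _ _ (valued_1 hV)
  (valued_N1 hV).
Qed.

Lemma valuedX e c n : V e c -> V (e ^+ n) (c ^+ n).
Proof.
move=> Ve; elim: n => [|n IH]; first by rewrite !expr0; exact: valued_1 hV.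
by rewrite !exprS; exact: valuedM hV _ _ _ _ Ve IH.
Qed.

Lemma valuedXz e c (n : int) : c != 0 -> V e c -> V (e ^ n) (c ^ n).
Proof.
move=> c0 Ve; case: n => n; first exact: valuedX.
by apply: (valuedV hV); [rewrite expf_neq0 | exact: valuedX].
Qed.

Lemma valued_neq0 e c : c != 0 -> V e c -> e != 0.
Proof.
move=> c0 Ve; apply: contra_neq c0 => e0; rewrite e0 in Ve.
exact: valued_uniq hV _ _ _ Ve valued_0.
Qed.

(** [t] and [t0] divide each other, so the residues of the two cofactors have product [1]. *)
Lemma unif_unit t : unif t -> exists u c, [/\ c != 0, V u c & t = t0 * u].
Proof.
move=> [/(valued_dvd hV)[u [c [Vu tE]]] tdvd]; exists u, c; split=> //.
have [r [d Vr] t0E] := tdvd _ (valued_param hV).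
have ur : u * r = 1.
  by apply: (mulfI (valued_param_neq0 hV)); rewrite mulrA -tE -t0E mulr1.
have := valuedM hV Vu Vr; rewrite ur => /(valued_uniq hV (valued_1 hV)) cd.
by apply/eqP => c0; move/eqP: cd; rewrite c0 mul0r oner_eq0.
Qed.

(** Replacing [t = t0 u] by [t0] multiplies the quotient by [u ^ n], a unit; so orders can be tested
    on the single parameter [t0]. *)
Lemma vordP e n : vord e n <-> exists c, c != 0 /\ V (e / t0 ^ n) c.
Proof.
split=> [[t [c [Ut c0 Ve]]]|[c [c0 Ve]]]; last first.
  by exists t0, c; split=> //; exact: unif_param.
have [u [d [d0 Vu tE]]] := unif_unit Ut.
exists (c * d ^ n); split; first by rewrite mulf_neq0 ?expfz_neq0.
have := valuedM hV Ve (valuedXz n d0 Vu).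
have u0 := valued_neq0 d0 Vu; have t00 := valued_param_neq0 hV.
by rewrite tE expfzMl invfM mulrA mulfVK ?expfz_neq0.
Qed.

Lemma vord_neq0 e n : vord e n -> e != 0.
Proof.
case/vordP => c [c0 /(valued_neq0 c0)].
by rewrite mulf_eq0 negb_or => /andP[].
Qed.

Lemma vord_exists e : e != 0 -> exists n, vord e n.
Proof.
by move/(valued_expand hV) => [n [c [c0 Ve]]]; exists n; apply/vordP; exists c.
Qed.

Lemma vordM e e' m n : vord e m -> vord e' n -> vord (e * e') (m + n).
Proof.
move=> /vordP[c [c0 Ve]] /vordP[c' [c'0 Ve']]; apply/vordP.
exists (c * c'); split; first by rewrite mulf_neq0.
by rewrite expfzDr ?(valued_param_neq0 hV) // -mulf_div;
  exact: valuedM hV _ _ _ _ Ve Ve'.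
Qed.

Lemma vordV e n : vord e n -> vord e^-1 (- n).
Proof.
move=> /vordP[c [c0 Ve]]; apply/vordP; exists c^-1; rewrite invr_eq0;
  split=> //.
by have := valuedV hV c0 Ve; rewrite invfM (invr_expz t0 n).
Qed.

Lemma vord_unit e c : c != 0 -> V e c -> vord e 0.
Proof. by move=> c0 Ve; apply/vordP; exists c; rewrite expr0z divr1. Qed.

Lemma vord_1 : vord 1 0.
Proof. exact: vord_unit (oner_neq0 _) (valued_1 hV). Qed.

Lemma vordX e n k : vord e n -> vord (e ^+ k) (n *+ k).
Proof.
move=> ve; elim: k => [|k IH]; first by rewrite expr0 mulr0n; exact: vord_1.
by rewrite exprS mulrS; exact: vordM.
Qed.

Lemma vord_param : vord t0 1.
Proof.
apply/vordP; exists 1; rewrite oner_neq0 expr1z divff ?(valued_param_neq0 hV)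
  //.
by split=> //; exact: valued_1 hV.
Qed.

Lemma vord_regular e n : vord e n -> 0 <= n -> exists c, V e c.
Proof.
case: n => // n /vordP[c [c0 Ve]] _.
(* The residue is [c] if [n = 0] and [0] otherwise; [0 ^+ n] covers both cases. *)
exists (c * 0 ^+ n).
have -> : e = e / t0 ^ n%:Z * t0 ^+ n by rewrite divfK ?expf_neq0
  ?(valued_param_neq0 hV).
exact: valuedM hV _ _ _ _ Ve (valuedX _ (valued_param hV)).
Qed.

Lemma vord_zero e n : vord e n -> 0 < n -> V e 0.
Proof.
case: n => // [[//|n]] /vordP[c [c0 Ve]] _.
rewrite -(mulr0 c) -[0](expr0n K n.+1).
have -> : e = e / t0 ^ n.+1%:Z * t0 ^+ n.+1.
  by rewrite divfK ?expf_neq0 ?(valued_param_neq0 hV).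
by apply: (valuedM hV) => //; have := valuedX n.+1 (valued_param hV);
  rewrite !expr0n.
Qed.

Lemma vord_uniq e m n : vord e m -> vord e n -> m = n.
Proof.
suff H e' m' n' : vord e' m' -> vord e' n' -> (m' <= n')%R.
  by move=> vm vn; apply/eqP; rewrite eq_le !(H e).
move=> vm vn; rewrite leNgt; apply/negP => lt.
(* Otherwise [1 = e' / e'] would have positive order, hence residue [0]. *)
have := vordM vm (vordV vn); rewrite divff ?(vord_neq0 vm) // => v1.
have V1 := vord_zero v1; rewrite subr_gt0 in V1.
by have /eqP := valued_uniq hV (valued_1 hV) (V1 lt); rewrite oner_eq0.
Qed.

Lemma vord_unitP e : vord e 0 -> exists c, c != 0 /\ V e c.
Proof. by case/vordP => c; rewrite expr0z divr1; exists c. Qed.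

Lemma vord_ge0 e c n : V e c -> vord e n -> 0 <= n.
Proof.
move=> Ve ve; rewrite leNgt; apply/negP => lt.
have Vi : V e^-1 0 by apply: vord_zero (vordV ve) _; rewrite oppr_gt0.
have := valuedM hV Ve Vi; rewrite divff ?(vord_neq0 ve) // mulr0.
by move/(valued_uniq hV (valued_1 hV))/eqP; rewrite oner_eq0.
Qed.

Lemma vord_gt0 e n : V e 0 -> vord e n -> 0 < n.
Proof.
move=> Ve ve; rewrite lt_neqAle (vord_ge0 Ve ve) andbT; apply/eqP => n0.
rewrite -n0 in ve; have [c [c0 Ve']] := vord_unitP ve.
by rewrite (valued_uniq hV Ve' Ve) eqxx in c0.
Qed.

(** In [e + e' = e (1 + e' / e)] the quotient [e' / e] has positive order, so the second factor has
    residue [1]. *)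
Lemma vord_addl e e' m n : vord e m -> vord e' n -> m < n -> vord (e + e') m.
Proof.
move=> ve ve' lt; have e0 := vord_neq0 ve.
have -> : e + e' = e * (1 + e' / e) by rewrite mulrDr mulr1 mulrC divfK.
rewrite -[m]addr0; apply: (vordM ve).
apply: (@vord_unit _ 1); first exact: oner_neq0.
rewrite -[1 in X in V _ X]addr0; apply: valuedD hV _ _ _ _ (valued_1 hV) _.
by apply: vord_zero (vordM ve' (vordV ve)) _; rewrite subr_gt0.
Qed.

(** With [t = t0 u], the term [t0 * d u] of [d t] has residue [0]; so the hypothesis on [t0] carries
    over to every uniformizer. *)
Lemma vord_derivation (d : E -> E) t :
    (forall a b, d (a * b) = d a * b + a * d b) ->
    (forall e c, V e c -> exists c', V (d e) c') ->
    (exists c, c != 0 /\ V (d t0) c) ->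
  unif t -> vord (d t) 0.
Proof.
move=> dM dV [c0 [c00 Vc0]] /unif_unit[u [c [nz Vu ->]]].
have [c' Vc'] := dV _ _ Vu; rewrite dM.
apply: (@vord_unit _ (c0 * c + 0 * c')); first by rewrite mul0r addr0 mulf_neq0.
by apply: valuedD hV _ _ _ _ _ _; apply: (valuedM hV) => //;
  exact: valued_param hV.
Qed.

End Valuation.

(** * The two charts of the curve *)

Section ChartValued.
Variables (K E : fieldType) (iota : {rmorphism K -> E}) (X Y : E).
Variables (H G : {poly K}).
Hypothesis XY_curve : Y ^+ 2 + ev iota X H * Y = ev iota X G.
Hypothesis XY_free : forall p q, ev iota X p + ev iota X q * Y = 0 -> p = 0 /\
  q = 0.
Hypothesis XY_gen : forall e, exists p q r,
  ev iota X r != 0 /\ e = (ev iota X p + ev iota X q * Y) / ev iota X r.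
Variables a b : K.
Hypothesis ab_curve : b ^+ 2 + H.[a] * b = G.[a].
Hypothesis ab_nonsing : ~ (2%:R * b + H.[a] = 0 /\ H^`().[a] * b - G^`().[a] =
  0).

Lemma chart_valued : valued (vat iota X Y a b) (param iota X Y H a b).
Proof.
have V c : vat iota X Y a b (iota c) c by apply: vat_iota.
split.
- by move=> e c c'; apply: (@vat_uniq _ _ iota X Y H G).
- by have := V 1; rewrite rmorph1.
- by have := V (-1); rewrite rmorphN1.
- by move=> *; apply: (@vatD _ _ iota X Y H G).
- by move=> *; apply: vatM.
- by move=> *; apply: vatV.
- exact: param_neq0 XY_free _ _.
- exact: (@param_vat _ _ iota X Y H G).
- by move=> s; apply: (@param_dvd _ _ iota X Y H G).
- by move=> e; apply: (@param_expand _ _ iota X Y H G).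
Qed.

End ChartValued.

Lemma add_frac_mul (E : fieldType) (y p1 d1 p2 d2 : E) : d1 != 0 -> d2 != 0 ->
  p1 / d1 + p2 / d2 * y = (p1 * d2 + p2 * d1 * y) / (d1 * d2).
Proof. by move=> d10 d20; field; rewrite d10 d20. Qed.

(* Sealed, because unifying two functions of the form [fpoly p] otherwise
   unfolds the arithmetic of the function field. *)
HB.lock Definition fpoly (K : fieldType) (g : nat) (C : imaginary_model K g)
  (p : {poly K}) : funfield C := of_ratfun C (@FracField.tofrac {poly K} p).
Arguments fpoly {K g} C p.

(** * The affine chart *)

Section FunctionField.
Variables (K : fieldType) (g : nat) (C : imaginary_model K g).
Local Notation E := (funfield C).
Local Notation ratfun := {fraction {poly K}}.
Local Notation fpoly := (fpoly C).
Local Notation tofrac := (@FracField.tofrac {poly K}).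

Lemma of_ratfun_is_zmod_morphism : zmod_morphism (of_ratfun C : ratfun -> E).
Proof.
by move=> r s; rewrite /of_ratfun polyCB; exact: (rmorphB (in_qpoly (curve_poly
  C))).
Qed.

Lemma of_ratfun_is_monoid_morphism : monoid_morphism (of_ratfun C : ratfun ->
  E).
Proof.
split; first exact: (rmorph1 (in_qpoly (curve_poly C))).
by move=> r s; rewrite /of_ratfun polyCM; exact: (rmorphM (in_qpoly (curve_poly
  C))).
Qed.

HB.instance Definition _ :=
  GRing.isZmodMorphism.Build ratfun E (of_ratfun C) of_ratfun_is_zmod_morphism.
HB.instance Definition _ :=
  GRing.isMonoidMorphism.Build ratfun E (of_ratfun C)
    of_ratfun_is_monoid_morphism.

Lemma fconst_is_zmod_morphism : zmod_morphism (fconst C : K -> E).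
Proof. by move=> c d; rewrite /fconst polyCB !rmorphB. Qed.

Lemma fconst_is_monoid_morphism : monoid_morphism (fconst C : K -> E).
Proof.
by split=> [|c d]; rewrite /fconst ?polyC1 ?polyCM ?rmorph1 ?rmorphM.
Qed.

HB.instance Definition _ :=
  GRing.isZmodMorphism.Build K E (fconst C) fconst_is_zmod_morphism.
HB.instance Definition _ :=
  GRing.isMonoidMorphism.Build K E (fconst C) fconst_is_monoid_morphism.

Lemma ev_fx p : ev (fconst C) (fx C) p = fpoly p.
Proof.
elim/poly_ind: p => [|p c IH]; first by rewrite ev0 fpoly.unlock !rmorph0.
by rewrite evD evM evX evC IH fpoly.unlock !(rmorphD, rmorphM).
Qed.

Lemma size_mk_curve_poly : size (mk_monic (curve_poly C)) = 3.
Proof. by rewrite mk_monicE ?size_curve_poly //; exact: curve_poly_irr. Qed.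

Lemma in_qpoly_small_eq0 (e : {poly ratfun}) : 
  in_qpoly (curve_poly C) e = 0 :> {poly %/ curve_poly C} -> (size e < 3)%N ->
    e = 0.
Proof.
move=> e0 sz; have := congr1 val e0; rewrite /= => <-.
by rewrite rmodp_small // size_mk_curve_poly.
Qed.

Lemma of_ratfun_free (r s : ratfun) :
  of_ratfun C r + of_ratfun C s * fy C = 0 -> r = 0 /\ s = 0.
Proof.
move=> E0; have : r%:P + s%:P * 'X = 0.
  apply: in_qpoly_small_eq0; first by rewrite rmorphD rmorphM.
  exact: size_linear_poly.
exact: linear_poly_eq0.
Qed.

Lemma fpolyM p q : fpoly (p * q) = fpoly p * fpoly q.
Proof. by rewrite fpoly.unlock !rmorphM. Qed.

Lemma fpolyD p q : fpoly (p + q) = fpoly p + fpoly q.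
Proof. by rewrite fpoly.unlock !rmorphD. Qed.

Lemma fpolyN p : fpoly (- p) = - fpoly p.
Proof. by rewrite fpoly.unlock !rmorphN. Qed.

Lemma fpoly0 : fpoly 0 = 0.
Proof. by rewrite fpoly.unlock !rmorph0. Qed.

Lemma fpoly1 : fpoly 1 = 1.
Proof. by rewrite fpoly.unlock !rmorph1. Qed.

Lemma fpolyC c : fpoly c%:P = fconst C c.
Proof. by rewrite fpoly.unlock. Qed.

Lemma fpolyX : fpoly 'X = fx C.
Proof. by rewrite fpoly.unlock. Qed.

Lemma fpoly_eq0 p : (fpoly p == 0) = (p == 0).
Proof. by rewrite fpoly.unlock fmorph_eq0 tofrac_eq0. Qed.

(** With [fxy_curve] and [fxy_gen], this supplies the hypotheses on the coordinates of a chart for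
    [x] and [y]. *)
Lemma fxy_free p q : ev (fconst C) (fx C) p + ev (fconst C) (fx C) q * fy C = 0
  ->
  p = 0 /\ q = 0.
Proof.
rewrite !ev_fx fpoly.unlock => /of_ratfun_free[/eqP p0 /eqP q0].
by move: p0 q0; rewrite !tofrac_eq0 => /eqP-> /eqP->.
Qed.

Lemma fxy_curve :
  fy C ^+ 2 + ev (fconst C) (fx C) (hpol C) * fy C = ev (fconst C) (fx C) (fpol
    C).
Proof.
rewrite !ev_fx fpoly.unlock; apply/eqP; rewrite -subr_eq0; apply/eqP.
transitivity (in_qpoly (curve_poly C) (curve_poly C) : E).
  by rewrite {2}/curve_poly rmorphB rmorphD rmorphXn -mul_polyC rmorphM.
apply: val_inj => /=; rewrite mk_monicE ?(Pdiv.RingMonic.rmodpp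
  (curve_poly_monic C)) //.
exact: curve_poly_irr.
Qed.

Lemma fxy_gen (e : E) : exists p q r,
  ev (fconst C) (fx C) r != 0 /\
  e = (ev (fconst C) (fx C) p + ev (fconst C) (fx C) q * fy C) / ev (fconst C)
    (fx C) r.
Proof.
have [r [s ->]] : exists r s : ratfun, e = of_ratfun C r + of_ratfun C s * fy C.
  exists (val e)`_0, (val e)`_1.
  have sz : (size (val e) <= 2)%N.
    rewrite -ltnS (leq_trans (size_mk_monic (e : {poly %/ curve_poly C}))) //.
    by rewrite size_mk_curve_poly.
  transitivity (in_qpoly (curve_poly C) (((val e)`_0)%:P + ((val e)`_1)%:P *
    'X) : E); last first.
    by rewrite rmorphD rmorphM.
  have <- : val e = ((val e)`_0)%:P + ((val e)`_1)%:P * 'X.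
    by rewrite -linear_polyE.
  by apply: val_inj; rewrite /= rmodp_small // size_mk_monic.
have [p1 [d1 [d10 ->]]] := ratfunP r; have [p2 [d2 [d20 ->]]] := ratfunP s.
exists (p1 * d2), (p2 * d1), (d1 * d2); rewrite !ev_fx fpoly_eq0 mulf_neq0 //;
  split=> //.
rewrite fpoly.unlock !rmorphM !fmorphV.
by apply: add_frac_mul; rewrite fmorph_eq0 tofrac_eq0.
Qed.

End FunctionField.

(** * Reversed polynomials and the chart at infinity *)

Section Reversal.
Variable R : nzRingType.

(** The reciprocal polynomial [X^n p(1/X)] when [size p <= n.+1]; the degree of [p] may be smaller
    than [n]. *)
Definition revn (n : nat) (p : {poly R}) : {poly R} := \poly_(i < n.+1) p`_(n -
  i).

Lemma coef_revn n (p : {poly R}) i : (revn n p)`_i = if (i <= n)%N then p`_(n -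
  i) else 0.
Proof. by rewrite coef_poly ltnS. Qed.

Lemma revn_eq0 n (p : {poly R}) : (size p <= n.+1)%N -> revn n p = 0 -> p = 0.
Proof.
move=> sz p0; apply/polyP => i; rewrite coef0.
have [le|lt] := leqP i n; last by rewrite nth_default // (leq_trans sz).
have := coef_revn n p (n - i); rewrite leq_subr subKn // p0 coef0.
by move=> <-.
Qed.
End Reversal.

Section ReversedChart.
Variables (K E : fieldType) (iota : {rmorphism K -> E}).

Lemma ev_revn (X : E) n (p : {poly K}) : X != 0 -> (size p <= n.+1)%N ->
  ev iota X p = X ^+ n * ev iota X^-1 (revn n p).
Proof.
move=> X0 sz; rewrite /ev (@horner_coef_wide _ n.+1) ?size_map_poly //.
rewrite (@horner_coef_wide _ n.+1) ?size_map_poly ?size_poly //.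
rewrite mulr_sumr (reindex_inj rev_ord_inj); apply: eq_bigr => i _ /=.
have le_in : (i <= n)%N by rewrite -ltnS.
rewrite !coef_map coef_revn le_in subSS mulrCA exprVn.
by congr (_ * _); apply: (canRL (mulfK (expf_neq0 _ X0))); rewrite -exprD subnK.
Qed.

Variables (X Y : E) (H G : {poly K}).
Hypothesis XY_curve : Y ^+ 2 + ev iota X H * Y = ev iota X G.
Hypothesis XY_free : forall p q, ev iota X p + ev iota X q * Y = 0 -> p = 0 /\
  q = 0.
Hypothesis XY_gen : forall e, exists p q r,
  ev iota X r != 0 /\ e = (ev iota X p + ev iota X q * Y) / ev iota X r.
Variable N : nat.
Hypotheses (szH : (size H <= N.+1)%N) (szG : (size G <= N.*2.+1)%N).
Local Notation Z := (X^-1).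
Local Notation W := (Y / X ^+ N).

Lemma coord_neq0 : X != 0.
Proof. by rewrite -(evX iota X) (ev_eq0 XY_free) polyX_eq0. Qed.
Let X0 := coord_neq0.

Lemma rev_curve : W ^+ 2 + ev iota Z (revn N H) * W = ev iota Z (revn N.*2 G).
Proof.
have XN : X ^+ N != 0 by rewrite expf_neq0.
apply: (mulfI (expf_neq0 N.*2 X0)); rewrite -ev_revn // -XY_curve.
rewrite (@ev_revn X N H) // -addnn exprD.
by field.
Qed.

Lemma rev_free p q : ev iota Z p + ev iota Z q * W = 0 -> p = 0 /\ q = 0.
Proof.
pose n := maxn (size p) (size q) => E0.
have szp : (size p <= n.+1)%N by rewrite leqW // leq_maxl.
have szq : (size q <= n.+1)%N by rewrite leqW // leq_maxr.
have Z0 : Z != 0 by rewrite invr_eq0.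
have XN m : X ^+ m != 0 by rewrite expf_neq0.
(* The relation is multiplied by [X^(n+N)]: [X^n] reverses [p] and [q], and [X^N] clears the
   denominator of [W]. *)
have [|] := @XY_free (revn n p * 'X^N) (revn n q).
  rewrite evM evXn evX.
  move: E0; rewrite (ev_revn Z0 szp) (ev_revn Z0 szq) invrK => E0.
  apply: (mulfI (expf_neq0 n Z0)); apply: (mulIf (invr_neq0 (XN N))).
  by rewrite mulr0 mul0r -E0; field; rewrite !XN.
move=> /eqP p0 /(revn_eq0 szq) ->; split=> //.
by move: p0; rewrite mulf_eq0 (negbTE (monic_neq0 (monicXn _ _))) orbF =>
  /eqP/(revn_eq0 szp).
Qed.

Lemma rev_gen e : exists p q r,
  ev iota Z r != 0 /\ e = (ev iota Z p + ev iota Z q * W) / ev iota Z r.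
Proof.
have [p [q [r [r0 ->]]]] := XY_gen e.
pose n := maxn (size p) (maxn (size q) (size r)).
have szp : (size p <= n.+1)%N by rewrite leqW // leq_maxl.
have szq : (size q <= n.+1)%N by rewrite leqW // !leq_max leqnn orbT.
have szr : (size r <= n.+1)%N by rewrite leqW // !leq_max leqnn !orbT.
have XN m : X ^+ m != 0 by rewrite expf_neq0.
exists (revn n p * 'X^N), (revn n q), (revn n r * 'X^N).
move: r0; rewrite !evM !evXn !evX (ev_revn X0 szp) (ev_revn X0 szq) (ev_revn X0
  szr).
rewrite mulf_eq0 negb_or => /andP[_ r0]; rewrite mulf_neq0 ?expf_neq0 ?invr_eq0
  //.
by split=> //; rewrite !exprVn; field; rewrite !XN r0.
Qed.

End ReversedChart.

(** * Orders of functions and of differentials *)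

Lemma deriv_inv_eq (E : fieldType) (x dx dz : E) : x != 0 ->
  0 = dx / x + x * dz -> dz = - dx / x ^+ 2.
Proof.
move=> x0 E0; apply: (mulfI x0); transitivity (- (dx / x)); last by field.
by apply/eqP; rewrite -addr_eq0 addrC -E0.
Qed.

Lemma infd_eq (E : fieldType) (x dx de de' : E) n : dx != 0 -> x != 0 -> (0 <
  n)%N ->
  de * (dx / x ^+ n.+1) = - dx / x ^+ 2 * de' -> de = - x ^+ n.-1 * de'.
Proof.
move=> dx0 x0; case: n => // n _ E0.
have xn : x ^+ n != 0 by rewrite expf_neq0.
apply: (mulIf (mulf_neq0 dx0 (invr_neq0 (expf_neq0 n.+2 x0)))).
by rewrite E0 !exprS /=; field; rewrite xn x0.
Qed.

Section Orders.
Variables (K : closedFieldType) (g : nat) (C : imaginary_model K g).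
Hypothesis ns : nonsingular C.
Local Notation E := (funfield C).
Local Notation X := (fx C).
Local Notation Y := (fy C).
Local Notation h := (hpol C).
Local Notation f := (fpol C).
Local Notation io := (fconst C).
Local Notation Z := ((fx C)^-1).
Local Notation W := (fy C / fx C ^+ g.+1).
Local Notation Hz := (revn g.+1 h).
Local Notation Gz := (revn g.+1.*2 f).

Lemma nonsingularP (p : affine_point C) :
  ~ (2%:R * (val p).2 + h.[(val p).1] = 0 /\
     h^`().[(val p).1] * (val p).2 - f^`().[(val p).1] = 0).
Proof. by have := ns p; case: p => [[a b] ?]. Qed.

Lemma affine_pointP (p : affine_point C) :
  (val p).2 ^+ 2 + h.[(val p).1] * (val p).2 = f.[(val p).1].
Proof. by apply/eqP; exact: (valP p). Qed.

Lemma value_at_affine (p : affine_point C) :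
  value_at (Some p) = vat io X Y (val p).1 (val p).2.
Proof. by case: p => [[a b] ?]. Qed.

Lemma value_at_pinf : value_at (pinf C) = vat io Z W 0 0.
Proof. by []. Qed.

Lemma szf_rev : (size f <= g.+1.*2.+1)%N.
Proof. by rewrite size_fpol doubleS. Qed.

Lemma szh_rev : (size h <= g.+2)%N.
Proof. by rewrite (leq_trans (size_hpol C)). Qed.

Definition inf_curve := rev_curve (fxy_curve C) (fxy_free (C := C)) szh_rev
  szf_rev.
Definition inf_free := rev_free (fxy_free (C := C)) (N := g.+1).
Definition inf_gen := rev_gen (fxy_free (C := C)) (fxy_gen (C := C)) g.+1.

(** The constant term of [Gz] is the coefficient of degree [2g+2] of [f], which has degree
    [2g+1]. *)
Lemma inf_point : 0 ^+ 2 + Hz.[0] * 0 = Gz.[0] :> K.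
Proof.
rewrite !horner_coef0 !coef_revn !subn0 mulr0 addr0 expr0n /=.
by rewrite nth_default // size_fpol doubleS.
Qed.

(** The constant term of [Hz] is the coefficient of degree [g+1] of [h], which vanishes. So [W] is
    the uniformizer at infinity. *)
Lemma inf_ramified : 2%:R * 0 + Hz.[0] = 0 :> K.
Proof.
rewrite mulr0 add0r horner_coef0 coef_revn subn0 /=.
by rewrite nth_default // size_hpol.
Qed.

(** The derivative of [Gz] at [0] is the leading coefficient [1] of [f]. *)
Lemma inf_nonsing : ~ (2%:R * 0 + Hz.[0] = 0 :> K /\ Hz^`().[0] * 0 -
  Gz^`().[0] = 0 :> K).
Proof.
case=> _ /eqP; rewrite mulr0 sub0r oppr_eq0 horner_coef0 coef_deriv mulr1n
  coef_revn.
rewrite doubleS /= subn1 /=.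
have := monicP (fpol_monic C); rewrite lead_coefE size_fpol /= => ->.
by rewrite oner_eq0.
Qed.

Lemma value_at_valued (P : point C) : exists t0, valued (value_at P) t0.
Proof.
case: P => [p|].
  rewrite value_at_affine; eexists; apply: chart_valued.
  - exact: fxy_curve.
  - exact: fxy_free.
  - exact: fxy_gen.
  - exact: affine_pointP.
  - exact: nonsingularP.
rewrite value_at_pinf; eexists; apply: chart_valued.
- exact: inf_curve.
- exact: inf_free.
- exact: inf_gen.
- exact: inf_point.
- exact: inf_nonsing.
Qed.

Section Local.
Variable P : point C.

Lemma is_ordM e e' m n : is_ord P e m -> is_ord P e' n -> is_ord P (e * e') (m
  + n).
Proof. by have [t0 tP] := value_at_valued P; apply: (vordM tP). Qed.

Lemma is_ordV e n : is_ord P e n -> is_ord P e^-1 (- n).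
Proof. by have [t0 tP] := value_at_valued P; apply: (vordV tP). Qed.

Lemma is_ordX e n k : is_ord P e n -> is_ord P (e ^+ k) (n *+ k).
Proof. by have [t0 tP] := value_at_valued P; apply: (vordX tP). Qed.

Lemma is_ord_unit e c : c != 0 -> value_at P e c -> is_ord P e 0.
Proof. by have [t0 tP] := value_at_valued P; apply: (vord_unit tP). Qed.

Lemma is_ord_neq0 e n : is_ord P e n -> e != 0.
Proof. by have [t0 tP] := value_at_valued P; apply: (vord_neq0 tP). Qed.

Lemma is_ord_exists e : e != 0 -> exists n, is_ord P e n.
Proof. by have [t0 tP] := value_at_valued P; apply: (vord_exists tP). Qed.

Lemma is_ord_uniq e m n : is_ord P e m -> is_ord P e n -> m = n.
Proof. by have [t0 tP] := value_at_valued P; apply: (vord_uniq tP). Qed.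

Lemma is_ord_regular e n : is_ord P e n -> 0 <= n -> exists c, value_at P e c.
Proof. by have [t0 tP] := value_at_valued P; apply: (vord_regular tP). Qed.

Lemma is_ord_zero e n : is_ord P e n -> 0 < n -> value_at P e 0.
Proof. by have [t0 tP] := value_at_valued P; apply: (vord_zero tP). Qed.

Lemma is_ord_gt0 e n : value_at P e 0 -> is_ord P e n -> 0 < n.
Proof. by have [t0 tP] := value_at_valued P; apply: (vord_gt0 tP). Qed.

Lemma is_ord_addl e e' m n :
  is_ord P e m -> is_ord P e' n -> m < n -> is_ord P (e + e') m.
Proof. by have [t0 tP] := value_at_valued P; apply: (vord_addl tP). Qed.

Lemma uniformizer_exists : exists t, uniformizer P t.
Proof.
by have [t0 tP] := value_at_valued P; exists t0; apply: (unif_param tP).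
Qed.

Lemma value_at_uniq e c c' : value_at P e c -> value_at P e c' -> c = c'.
Proof. by have [t0 tP] := value_at_valued P; apply: (valued_uniq tP). Qed.

Lemma is_ord_const c : c != 0 -> is_ord P (io c) 0.
Proof.
move=> c0; apply: (is_ord_unit c0).
by case: P => [p|]; rewrite ?value_at_affine ?value_at_pinf; exact: vat_iota.
Qed.

End Local.

Lemma pinf_valued : valued (value_at (pinf C)) W.
Proof.
have := chart_valued inf_curve inf_free inf_gen inf_point inf_nonsing.
by rewrite -value_at_pinf /param inf_ramified eqxx rmorph0 subr0.
Qed.

Lemma fx_neq0 : X != 0.
Proof. exact: coord_neq0 (fxy_free (C := C)). Qed.

(** By [chart_ramified], [1/x] is [W^2] times a unit. *)
Lemma is_ord_inf_x : is_ord (pinf C) X (-2%:Z).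
Proof.
have [e [c [Ve c0 ZE]]] := chart_ramified inf_curve inf_free inf_point
  inf_nonsing inf_ramified.
rewrite rmorph0 !subr0 in ZE; rewrite -[X]invrK; apply: is_ordV.
have ue : is_ord (pinf C) e 0 by apply: (is_ord_unit c0); rewrite value_at_pinf.
have := is_ordM (is_ordX 2 (vord_param pinf_valued)) ue.
by rewrite ZE addr0.
Qed.

(** From [y = W x^(g+1)], the order is [1 - 2(g+1)]. *)
Lemma is_ord_inf_y : is_ord (pinf C) Y (- (g.*2.+1)%:Z).
Proof.
have := is_ordM (vord_param pinf_valued) (is_ordX g.+1 is_ord_inf_x).
rewrite divfK ?expf_neq0 ?fx_neq0 //.
by have -> : 1 + - 2%:Z *+ g.+1 = - (g.*2.+1)%:Z by lia.
Qed.

(** [p(x)] is [x^(deg p)] times the reversed polynomial in [1/x], whose value at infinity is the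
    leading coefficient of [p]. *)
Lemma is_ord_inf_poly p : p != 0 -> is_ord (pinf C) (fpoly C p) (- ((size
  p).-1.*2)%:Z).
Proof.
move=> p0; rewrite -ev_fx (@ev_revn _ _ _ X (size p).-1) ?fx_neq0 //;
  last first.
  by rewrite prednK // size_poly_gt0.
have -> : - ((size p).-1.*2)%:Z = - 2%:Z *+ (size p).-1 + 0 by lia.
apply: is_ordM (is_ordX _ is_ord_inf_x) _.
apply: (@is_ord_unit _ _ (lead_coef p)); first by rewrite lead_coef_eq0.
rewrite value_at_pinf; have := vat_ev io Z W 0 0 (revn (size p).-1 p).
by rewrite horner_coef0 coef_revn subn0.
Qed.

Lemma value_at_poly (p : affine_point C) q :
  value_at (Some p) (fpoly C q) q.[(val p).1].
Proof. by rewrite value_at_affine -ev_fx; exact: vat_ev. Qed.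

Lemma value_at_y (p : affine_point C) : value_at (Some p) Y (val p).2.
Proof. by rewrite value_at_affine; exact: vatY. Qed.

Definition dlt := delta h f (fxy_gen (C := C)).

Lemma dlt_x : dlt X = Y *+ 2 + fpoly C h.
Proof.
by rewrite -ev_fx; exact: deltaX (fxy_curve C) (fxy_free (C := C)) _.
Qed.

Lemma dlt_y : dlt Y = fpoly C f^`() - fpoly C h^`() * Y.
Proof.
by rewrite -!ev_fx; exact: deltaY (fxy_curve C) (fxy_free (C := C)) _.
Qed.

Lemma dlt_poly p : dlt (fpoly C p) = fpoly C p^`() * (Y *+ 2 + fpoly C h).
Proof.
rewrite -!ev_fx.
exact: (delta_ev (fxy_curve C) (fxy_free (C := C)) (fxy_gen (C := C)) p).
Qed.

Lemma dltD : {morph dlt : a b / a + b}.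
Proof.
exact: (deltaD (fxy_curve C) (fxy_free (C := C)) (fxy_gen (C := C))).
Qed.

Lemma dltM a b : dlt (a * b) = dlt a * b + a * dlt b.
Proof.
exact: (deltaM (fxy_curve C) (fxy_free (C := C)) (fxy_gen (C := C)) a b).
Qed.

Lemma dlt_const c : dlt (io c) = 0.
Proof.
exact: (delta_iota (fxy_curve C) (fxy_free (C := C)) (fxy_gen (C := C)) c).
Qed.

Hypothesis g_gt0 : (0 < g)%N.

(* If [2y + h = 0] then [K] has characteristic two and [h = 0], so that every
   zero of [f'] lifts to a singular point. *)
Lemma dlt_x_neq0 : dlt X != 0.
Proof.
apply/eqP; rewrite dlt_x -ev_fx => d0.
have [h0 two0] : h = 0 /\ (2%:R : {poly K}) = 0.
  apply: (@fxy_free _ _ C); rewrite -mulr_natl in d0.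
  rewrite addrC !ev_fx in d0 *.
  by rewrite -d0 fpoly.unlock !rmorph_nat.
have two : (2%:R : K) = 0.
  by apply: (@polyC_inj K); rewrite rmorph_nat two0.
(* In characteristic two the coefficient [2g+1] of [x^(2g)] in the derivative of [f] is [1]; as
   [g > 0], the derivative is not constant. *)
have [a fa] : exists a, root f^`() a.
  apply/closed_rootP/eqP => sz1.
  have : f^`()`_(g.*2) = 1.
    rewrite coef_deriv; have := monicP (fpol_monic C).
    rewrite lead_coefE size_fpol /= => ->.
    by rewrite mulrS -mul2n mulrnA two mul0rn addr0.
  rewrite nth_default ?sz1; first by move/esym/eqP; rewrite oner_eq0.
  by rewrite double_gt0.
have [b fb] : exists b, root ('X^2 - f.[a]%:P) b.
  by apply/closed_rootP; rewrite size_XnsubC.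
have onC : b ^+ 2 + h.[a] * b == f.[a].
  by move: fb; rewrite /root h0 !hornerE subr_eq0.
apply: (@nonsingularP (Sub (a, b) onC)); rewrite SubK /= h0 deriv0 !horner0 two.
by rewrite !mul0r addr0 sub0r (eqP fa) oppr0.
Qed.

Let infd := delta Hz Gz inf_gen.

Lemma infd_z : infd Z = dlt X / X ^+ g.+1.
Proof.
rewrite /infd (deltaX inf_curve inf_free) dlt_x -ev_fx.
rewrite (ev_revn io fx_neq0 szh_rev) mulrDl -mulrnAl; congr (_ + _).
by rewrite mulrC mulKf ?expf_neq0 ?fx_neq0.
Qed.

(** The two derivations are proportional, and the factor is read off at [Z]:
    [dlt Z = - dlt X / X^2], while [infd Z = dlt X / X^(g+1)]. *)
Lemma dlt_infd e : dlt e = - X ^+ g.-1 * infd e.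
Proof.
have := derivation_delta inf_curve inf_free inf_gen dltD dltM dlt_const e.
have dz : dlt Z = - dlt X / X ^+ 2.
  have d1 : dlt 1 = 0 by rewrite -(dlt_const 1) (rmorph1 io).
  have E1 := dltM X Z; rewrite (divff fx_neq0) d1 in E1.
  exact: (deriv_inv_eq fx_neq0 E1).
rewrite -/infd infd_z dz => E1.
exact: (infd_eq dlt_x_neq0 fx_neq0 g_gt0 E1).
Qed.

(** Both [dlt] at affine points and [infd] at infinity turn a uniformizer into a unit, by
    [delta_param]; the factor [- X^(g-1)] has order [-2(g-1)] at infinity. *)
Lemma is_ord_dlt (P : point C) t : uniformizer P t ->
  is_ord P (dlt t) (if P is None then - (g.-1.*2)%:Z else 0).
Proof.
case: P => [p|] Ut.
  have V := chart_valued (fxy_curve C) (fxy_free (C := C)) (fxy_gen (C := C))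
    (affine_pointP p) (@nonsingularP p).
  rewrite -value_at_affine in V; apply: (vord_derivation V dltM _ _ Ut).
    move=> e c; rewrite value_at_affine.
    exact: (vat_delta (fxy_curve C) (fxy_free (C := C)) (fxy_gen (C := C))
      (affine_pointP p)).
  rewrite value_at_affine.
  exact: (delta_param (fxy_curve C) (fxy_free (C := C)) (fxy_gen (C := C))
    (affine_pointP p) (@nonsingularP p)).
have dM a b : infd (a * b) = infd a * b + a * infd b.
  exact: (deltaM inf_curve inf_free inf_gen a b).
have ut : is_ord (pinf C) (infd t) 0.
  apply: (vord_derivation pinf_valued dM _ _ Ut).
    by move=> e c; rewrite value_at_pinf; exact: (vat_delta inf_curve inf_free
      inf_gen inf_point).
  rewrite value_at_pinf; have := delta_param inf_curve inf_free inf_gen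
    inf_point inf_nonsing.
  by rewrite /param inf_ramified eqxx rmorph0 subr0.
have u1 : is_ord (pinf C) (io (-1)) 0.
  by apply: is_ord_const; rewrite oppr_eq0 oner_eq0.
have := is_ordM (is_ordM u1 (is_ordX g.-1 is_ord_inf_x)) ut.
rewrite (rmorphN1 io) mulN1r -dlt_infd.
by have -> : 0 + - 2%:Z *+ g.-1 + 0 = - (g.-1.*2)%:Z by lia.
Qed.

End Orders.

(** * Functions regular on the affine curve *)

Lemma ramified_cofactor (E : fieldType) (p1 q x y eta e s : E) :
    x != 0 -> y - eta != 0 -> x = (y - eta) ^+ 2 * e ->
  p1 * x - q * eta + q * y = x * s -> q = (y - eta) * (e * (s - p1)).
Proof.
move=> x0 y0 xE E0; apply: (mulIf y0).
have -> : q * (y - eta) = x * (s - p1).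
  by rewrite [x * (s - p1)]mulrBr -E0; ring.
by rewrite xE; ring.
Qed.

Lemma mulf_div_cancel (E : fieldType) (x y s : E) : x != 0 -> y != 0 ->
  s = x * (y * (s / (y * x))).
Proof. by move=> x0 y0; field; rewrite x0 y0. Qed.

Lemma common_factor_div (E : fieldType) (p q r x y : E) : x != 0 -> r != 0 ->
  (p * x + q * x * y) / (r * x) = (p + q * y) / r.
Proof. by move=> x0 r0; field; rewrite x0 r0. Qed.

Section RegularFunctions.
Variables (K : closedFieldType) (g : nat) (C : imaginary_model K g).
Hypothesis ns : nonsingular C.
Local Notation E := (funfield C).
Local Notation X := (fx C).
Local Notation Y := (fy C).
Local Notation h := (hpol C).
Local Notation f := (fpol C).
Local Notation io := (fconst C).
Local Notation fp := (fpoly C).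

Definition affine_regular (e : E) :=
  forall p : affine_point C, exists c, value_at (Some p) e c.

Lemma value_atD (P : point C) e e' c c' :
  value_at P e c -> value_at P e' c' -> value_at P (e + e') (c + c').
Proof. by have [t0 tP] := value_at_valued ns P; apply: (valuedD tP). Qed.

Lemma value_atM (P : point C) e e' c c' :
  value_at P e c -> value_at P e' c' -> value_at P (e * e') (c * c').
Proof. by have [t0 tP] := value_at_valued ns P; apply: (valuedM tP). Qed.

Lemma value_at_linear (p : affine_point C) q r :
  value_at (Some p) (fp q + fp r * Y) (q.[(val p).1] + r.[(val p).1] * (val
    p).2).
Proof.
apply: value_atD; first exact: (value_at_poly).
by apply: value_atM; [exact: (value_at_poly) | exact: (value_at_y)].
Qed.

Lemma value_at_const (p : affine_point C) c : value_at (Some p) (io c) c.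
Proof. by have := value_at_poly p c%:P; rewrite hornerC fpolyC. Qed.

Lemma affine_point_exists (a : K) : exists p : affine_point C, (val p).1 = a.
Proof.
have [b] : exists b, root ('X^2 + (h.[a] *: 'X - f.[a]%:P)) b.
  apply/closed_rootP; rewrite size_polyDl ?size_polyXn //.
  rewrite (leq_ltn_trans (size_polyD _ _)) // gtn_max size_polyN.
  rewrite (leq_ltn_trans (size_scale_leq _ _)) ?size_polyX //=.
  by rewrite (leq_ltn_trans (size_polyC_leq1 _)).
rewrite /root !hornerE ?addrA subr_eq0 => onC.
by exists (Sub (a, b) onC); rewrite SubK.
Qed.

(** This is the cancellation step of [affine_regularP]. Since [q + r y] vanishes at every point
    above [a], it suffices to show [r(a) = 0]. *)
Lemma root_of_regular (q r : {poly K}) s a :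
    (forall p : affine_point C, (val p).1 = a -> exists c, value_at (Some p) s
      c) ->
    fp q + fp r * Y = fp ('X - a%:P) * s ->
  root q a /\ root r a.
Proof.
move=> sreg E0.
have vanish (p : affine_point C) : (val p).1 = a -> q.[a] + r.[a] * (val p).2 =
  0.
  move=> pa; have [c Vc] := sreg p pa.
  have := value_atM (value_at_poly p ('X - a%:P)) Vc.
  rewrite -E0 => /(value_at_uniq ns (value_at_linear p q r)).
  by rewrite pa !hornerE subrr mul0r.
have [p pa] := affine_point_exists a.
suff ra : r.[a] = 0.
  by split; apply/eqP => //; have := vanish p pa; rewrite ra mul0r addr0.
have [ram|unr] := eqVneq (2%:R * (val p).2 + h.[a]) 0; last first.
  (* The hyperelliptic involution gives a second point above [a]. Subtracting the two vanishing
     conditions leaves [r(a) (2b + h(a)) = 0], with [b] the ordinate of [p]. *)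
  have onC : (- h.[a] - (val p).2) ^+ 2 + h.[a] * (- h.[a] - (val p).2) ==
    f.[a].
    have := affine_pointP p; rewrite pa => <-; apply/eqP; ring.
  have := vanish (Sub (a, - h.[a] - (val p).2) onC);
    rewrite SubK /= => /(_ erefl) v2.
  apply: (mulIf unr); rewrite mul0r.
  transitivity ((q.[a] + r.[a] * (val p).2) - (q.[a] + r.[a] * (- h.[a] - (val
    p).2))).
    by ring.
  by rewrite v2 (vanish p pa) subrr.
have ram' : 2%:R * (val p).2 + h.[(val p).1] = 0 by rewrite pa.
have [e [c [Ve c0 XE]]] := chart_ramified (fxy_curve C) (fxy_free (C := C))
  (affine_pointP p) (nonsingularP ns (p := p)) ram'.
rewrite -value_at_affine in Ve; rewrite pa in XE.
(* Now [q + r y = p1 (x - a) + r (y - b)], and [x - a] is [(y - b)^2] times a unit; so [r] is a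
   multiple of [y - b] in the local ring and vanishes at [p]. *)
have : root (q + r * ((val p).2)%:P) a by rewrite /root !hornerE (vanish p pa).
case/factor_theorem => p1 p1E.
have [c' Vs] := sreg p pa.
have XaE : fp ('X - a%:P) = X - io a by rewrite fpolyD fpolyN fpolyX fpolyC.
have Xa0 : X - io a != 0 by rewrite -XaE fpoly_eq0 polyXsubC_eq0.
have Y0 : Y - io (val p).2 != 0.
  by apply: contra_neq Xa0 => Y0; rewrite XE Y0 expr0n mul0r.
have rE : fp r = (Y - io (val p).2) * (e * (s - fp p1)).
  have E1 : fp p1 * (X - io a) = fp q + fp r * io (val p).2.
    have := congr1 fp p1E; rewrite (fpolyD C q) (fpolyM C r) (fpolyM C p1) XaE.
    by rewrite fpolyC.
  rewrite XaE in E0.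
  apply: (ramified_cofactor Xa0 Y0 XE); rewrite -E0.
  congr (_ + _); apply/eqP; rewrite subr_eq.
  exact/eqP.
have VY : value_at (Some p) (Y - io (val p).2) 0.
  have := value_atD (value_at_y p) (value_at_const p (- (val p).2)).
  by rewrite subrr (rmorphN io).
have Vp1 : value_at (Some p) (- fp p1) (- p1).[a].
  by rewrite -fpolyN -pa; exact: (value_at_poly).
have := value_atM VY (value_atM Ve (value_atD Vs Vp1)).
rewrite -rE mul0r => /(value_at_uniq ns (value_at_poly p r)).
by rewrite pa.
Qed.

(** Induction on the size of the denominator: unless it is constant it has a root [a], and
    [root_of_regular] cancels [x - a]. *)
Lemma affine_regularP e : affine_regular e -> exists p q, e = fp p + fp q * Y.
Proof.
have [p0 [q0 [r0 [nz ->]]]] := fxy_gen e; rewrite !ev_fx in nz *.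
rewrite fpoly_eq0 in nz.
elim: {r0}(size r0) {-2}r0 (leqnn (size r0)) nz p0 q0 => [|n IH] r sz r0 p q
  reg.
  by rewrite -size_poly_gt0 ltnNge sz in r0.
have [/eqP sz1|sz1] := boolP (size r == 1).
  have [c c0 rE] : exists2 c, c != 0 & r = c%:P by apply/size_poly1P/eqP.
  exists (p * c^-1%:P), (q * c^-1%:P); rewrite rE !fpolyM !fpolyC fmorphV.
  by rewrite mulrAC -mulrDl.
have [a /factor_theorem[r1 rE]] := closed_rootP _ sz1.
have r10 : r1 != 0 by apply: contra_neq r0 => r10; rewrite rE r10 mul0r.
have sz_r1 : (size r1 <= n)%N.
  by move: sz; rewrite rE size_Mmonic ?monicXsubC // size_XsubC addn2 ltnS.
have Xa0 : fp ('X - a%:P) != 0 by rewrite fpoly_eq0 polyXsubC_eq0.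
have fr10 : fp r1 != 0 by rewrite fpoly_eq0.
have frE : fp r = fp r1 * fp ('X - a%:P) by rewrite rE fpolyM.
have [||/factor_theorem[p1 pE] /factor_theorem[q1 qE]] :=
  @root_of_regular p q (fp r1 * ((fp p + fp q * Y) / fp r)) a.
- move=> P _; have [c Vc] := reg P.
  by exists (r1.[(val P).1] * c); apply: value_atM Vc; exact: (value_at_poly).
- by rewrite frE; apply: mulf_div_cancel.
have eE : (fp p + fp q * Y) / fp r = (fp p1 + fp q1 * Y) / fp r1.
  rewrite frE pE qE (fpolyM C p1) (fpolyM C q1); exact: common_factor_div.
by rewrite eE in reg *; apply: IH.
Qed.

(** If nonzero, [p(x)] has even order and [q(x) y] odd order at most [-(2g+1)]. By parity the orders
    differ, so the sum has the smaller one. *)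
Lemma inf_order_linear p q n : fp p + fp q * Y != 0 ->
    is_ord (pinf C) (fp p + fp q * Y) n -> - (g.*2)%:Z < n ->
  q = 0.
Proof.
move=> e0 ord_e n_ge; apply/eqP; apply/negP => /negP q0.
have oq : is_ord (pinf C) (fp q * Y) (- ((size q).-1.*2)%:Z - (g.*2.+1)%:Z).
  exact: (is_ordM ns (is_ord_inf_poly ns q0) (is_ord_inf_y ns)).
have [p0|p0] := eqVneq p 0.
  rewrite p0 !fpoly0 add0r in ord_e.
  have := is_ord_uniq ns oq ord_e; lia.
have op := is_ord_inf_poly ns p0.
have [lt|ge] := ltP (- ((size p).-1.*2)%:Z) (- ((size q).-1.*2)%:Z -
  (g.*2.+1)%:Z).
  have := is_ord_uniq ns (is_ord_addl ns op oq lt) ord_e; lia.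
have lt : - ((size q).-1.*2)%:Z - (g.*2.+1)%:Z < - ((size p).-1.*2)%:Z by lia.
rewrite addrC in ord_e.
have := is_ord_uniq ns (is_ord_addl ns oq op lt) ord_e; lia.
Qed.

End RegularFunctions.

(** * Rational functions and Mumford divisors *)

Section QuadraticSubfield.
Variables (R : idomainType) (E : fieldType) (T : {rmorphism R -> E}) (y : E) (h
  f : R).
Hypothesis y_curve : y ^+ 2 + T h * y = T f.
Hypothesis y_free : forall a b, T a + T b * y = 0 -> a = 0 /\ b = 0.

(** For [T := base_poly iota C] and [y := fy CK] this is [rational_fun]; the lemmas below show that
    it is closed under the field operations. *)
Definition quad (e : E) := exists a b c, c != 0 /\ e = (T a + T b * y) / T c.

Lemma quad_denom_neq0 c : c != 0 -> T c != 0.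
Proof.
apply: contra_neq => Tc; have [] := @y_free c 0; last by [].
by rewrite Tc rmorph0 mul0r addr0.
Qed.

Lemma quad_base a : quad (T a).
Proof.
by exists a, 0, 1; rewrite rmorph0 rmorph1 mul0r addr0 divr1 oner_neq0.
Qed.

Lemma quad_y : quad y.
Proof.
by exists 0, 1, 1; rewrite rmorph0 rmorph1 mul1r add0r divr1 oner_neq0.
Qed.

Lemma quadD e1 e2 : quad e1 -> quad e2 -> quad (e1 + e2).
Proof.
move=> [a1 [b1 [c1 [c10 ->]]]] [a2 [b2 [c2 [c20 ->]]]].
exists (a1 * c2 + a2 * c1), (b1 * c2 + b2 * c1), (c1 * c2);
  rewrite mulf_neq0 //.
split=> //; rewrite !(rmorphD, rmorphM).
by field; rewrite !quad_denom_neq0.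
Qed.

Lemma quadM e1 e2 : quad e1 -> quad e2 -> quad (e1 * e2).
Proof.
move=> [a1 [b1 [c1 [c10 ->]]]] [a2 [b2 [c2 [c20 ->]]]].
exists (a1 * a2 + b1 * b2 * f), (a1 * b2 + a2 * b1 - b1 * b2 * h), (c1 * c2).
rewrite mulf_neq0 //; split=> //; rewrite !(rmorphB, rmorphD, rmorphM) -y_curve.
by field; rewrite !quad_denom_neq0.
Qed.

Lemma quadN e : quad e -> quad (- e).
Proof.
by move=> qe; rewrite -mulN1r -(rmorphN1 T); apply: quadM => //;
  apply: quad_base.
Qed.

Lemma quadV e : quad e -> quad e^-1.
Proof.
move=> [a [b [c [c0 ->]]]].
have [e0|e0] := eqVneq (T a + T b * y) 0.
  by rewrite e0 mul0r invr0 -(rmorph0 T); apply: quad_base.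
(* The norm of [a + b y], its product with the conjugate [a - b h - b y]. *)
pose n := a ^+ 2 - a * b * h - b ^+ 2 * f.
have nE : T n = (T a + T b * y) * (T (a - b * h) + T (- b) * y).
  by rewrite /n !(rmorphB, rmorphD, rmorphM, rmorphN, rmorphXn) -y_curve; ring.
have Tn0 : T n != 0.
  rewrite nE mulf_neq0 //; apply: contra_neq e0 => /y_free[+ /eqP].
  by rewrite oppr_eq0 => + /eqP b0; rewrite b0 mul0r subr0 => ->;
    rewrite rmorph0 mul0r addr0.
exists (c * (a - b * h)), (- (c * b)), n; split.
  by apply: contra_neq Tn0 => ->; rewrite rmorph0.
apply: (mulIf Tn0); rewrite [RHS]divfK //.
rewrite nE !(rmorphB, rmorphM, rmorphN).
by field; rewrite e0 quad_denom_neq0.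
Qed.

End QuadraticSubfield.

(** * Orders of polynomials in [x] and multiplicities of their roots *)

Section MultiplicityOrder.
Variables (K : closedFieldType) (g : nat) (C : imaginary_model K g).
Hypothesis ns : nonsingular C.
Local Notation fp := (fpoly C).

Lemma multiplicity_mup (q : {poly K}) x : q != 0 ->
  exists2 q1, ~~ root q1 x & q = q1 * ('X - x%:P) ^+ mup x q.
Proof.
move=> q0; have [m [q1 q1x qE]] := multiplicity_XsubC q x.
rewrite q0 /= in q1x; exists q1 => //.
by rewrite {1}qE; congr (_ * _ ^+ _); rewrite qE mupMr // mup_XsubCX eqxx.
Qed.

Lemma is_ord_mup_of (p : affine_point C) (q : {poly K}) n : q != 0 ->
    is_ord (Some p) (fp ('X - (val p).1%:P)) n ->
  is_ord (Some p) (fp q) (n *+ mup (val p).1 q).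
Proof.
move=> q0 on; have [q1 q1x {1}->] := multiplicity_mup (val p).1 q0.
have o1 : is_ord (Some p) (fp q1) 0 by apply: is_ord_unit q1x (value_at_poly p
  q1).
rewrite fpolyM; have := is_ordM ns o1 (is_ordX ns (mup (val p).1 q) on).
rewrite add0r; suff -> : fp (('X - (val p).1%:P) ^+ mup (val p).1 q) =
    fp ('X - (val p).1%:P) ^+ mup (val p).1 q by [].
by elim: (mup _ q) => [|k IH]; rewrite ?expr0 ?fpoly1 // !exprS fpolyM IH.
Qed.

Lemma is_ord_ge_mup (p : affine_point C) (q : {poly K}) : q != 0 ->
  exists2 n, is_ord (Some p) (fp q) n & (mup (val p).1 q)%:Z <= n.
Proof.
move=> q0; have xp0 : fp ('X - (val p).1%:P) != 0 by rewrite fpoly_eq0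
  polyXsubC_eq0.
have [n on] := is_ord_exists ns (Some p) xp0.
exists (n *+ mup (val p).1 q); first exact: is_ord_mup_of.
have n_gt0 : 0 < n.
  apply: (is_ord_gt0 ns _ on); have := value_at_poly p ('X - (val p).1%:P).
  by rewrite !hornerE subrr.
by move: n_gt0; clear; nia.
Qed.

(** At an unramified point the linear factor is the uniformizer [param], of order exactly one. *)
Lemma is_ord_mup (p : affine_point C) (q : {poly K}) : q != 0 ->
    2%:R * (val p).2 + (hpol C).[(val p).1] != 0 ->
  is_ord (Some p) (fp q) (mup (val p).1 q).
Proof.
move=> q0 unr; rewrite -[X in is_ord _ _ X]natz; apply: is_ord_mup_of => //.
have V := chart_valued (fxy_curve C) (fxy_free (C := C)) (fxy_gen (C := C))
  (affine_pointP p) (nonsingularP ns (p := p)).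
rewrite -value_at_affine in V; have := vord_param V.
by rewrite /param (negbTE unr) fpolyD fpolyN fpolyX fpolyC.
Qed.

(** Over an algebraically closed field [q] is a product of linear factors up to a scalar; removing
    them one by one shows that [q] divides [p]. *)
Lemma size_le_of_mup (p q : {poly K}) : p != 0 -> q != 0 ->
  (forall x, (mup x q <= mup x p)%N) -> (size q <= size p)%N.
Proof.
have [s ->] := closed_field_poly_normal q => p0 q0.
have lc0 : lead_coef q != 0 by apply: contra_neq q0 => ->; rewrite scale0r.
rewrite size_scale // => mupP.
have {}mupP x : (count_mem x s <= mup x p)%N.
  rewrite -mu_prod_XsubC (leq_trans _ (mupP x)) // -mul_polyC mupMr //.
  by rewrite rootC.
apply: dvdp_leq => //; elim: s p p0 mupP {q0 lc0} => [|x s IH] p p0 mupP.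
  by rewrite big_nil dvd1p.
have /factor_theorem[p1 pE] : root p x.
  by rewrite -dvdp_XsubCl XsubC_dvd // (leq_trans _ (mupP x)) //= eqxx.
rewrite big_cons pE mulrC dvdp_mul2r ?polyXsubC_eq0 //.
have p10 : p1 != 0 by apply: contra_neq p0 => p10; rewrite pE p10 mul0r.
apply: IH => // z; have := mupP z.
by rewrite pE mupM ?polyXsubC_eq0 // (@mup_XsubCX _ 1) /= addnC leq_add2r.
Qed.

End MultiplicityOrder.

(** * The functions defined over [F] *)

Section RationalFunctions.
Variables (F : fieldType) (K : closedFieldType) (iota : {rmorphism F -> K}).
Variables (g : nat) (C : imaginary_model F g).
Local Notation CK := (base_change iota C).
Local Notation "p ^i" := (map_poly iota p) (at level 2, format "p ^i").

Lemma base_polyE p : base_poly iota C p = fpoly CK p^i.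
Proof. by rewrite fpoly.unlock. Qed.

Lemma base_poly_is_zmod_morphism : zmod_morphism (base_poly iota C).
Proof. by move=> p q; rewrite !base_polyE rmorphB fpolyD fpolyN. Qed.

Lemma base_poly_is_monoid_morphism : monoid_morphism (base_poly iota C).
Proof.
by split=> [|p q]; rewrite !base_polyE ?rmorph1 ?fpoly1 // rmorphM fpolyM.
Qed.

HB.instance Definition _ := GRing.isZmodMorphism.Build {poly F} (funfield CK)
  (base_poly iota C) base_poly_is_zmod_morphism.
HB.instance Definition _ := GRing.isMonoidMorphism.Build {poly F} (funfield CK)
  (base_poly iota C) base_poly_is_monoid_morphism.

Lemma base_curve : fy CK ^+ 2 + base_poly iota C (hpol C) * fy CK = base_poly
  iota C (fpol C).
Proof. by rewrite !base_polyE; have := fxy_curve CK; rewrite !ev_fx. Qed.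

Lemma base_free a b : base_poly iota C a + base_poly iota C b * fy CK = 0 -> a
  = 0 /\ b = 0.
Proof.
rewrite !base_polyE -!ev_fx => /fxy_free[/eqP a0 /eqP b0].
by move: a0 b0; rewrite !map_poly_eq0 => /eqP-> /eqP->.
Qed.

Lemma rational_quad phi :
  rational_fun phi = quad [the {rmorphism {poly F} -> funfield CK} of base_poly
    iota C] (fy CK) phi.
Proof. by []. Qed.

Lemma rational_poly p : rational_fun (fpoly CK p^i).
Proof. by rewrite -base_polyE rational_quad; apply: quad_base. Qed.

Lemma rational_x : rational_fun (fx CK).
Proof. by have := rational_poly 'X; rewrite map_polyX fpolyX. Qed.

Lemma rational_y : rational_fun (fy CK).
Proof. by rewrite rational_quad; apply: quad_y. Qed.

Lemma rationalD (e1 e2 : funfield CK) :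
  rational_fun e1 -> rational_fun e2 -> rational_fun (e1 + e2).
Proof. by rewrite !rational_quad; apply: (quadD base_free). Qed.

Lemma rationalM (e1 e2 : funfield CK) :
  rational_fun e1 -> rational_fun e2 -> rational_fun (e1 * e2).
Proof. by rewrite !rational_quad; apply: (quadM base_curve base_free). Qed.

Lemma rationalN (e : funfield CK) : rational_fun e -> rational_fun (- e).
Proof. by rewrite !rational_quad; apply: (quadN base_curve base_free). Qed.

Lemma rationalV (e : funfield CK) : rational_fun e -> rational_fun e^-1.
Proof. by rewrite !rational_quad; apply: (quadV base_curve base_free). Qed.

Lemma rational_dlt_x : rational_fun (dlt (fx CK)).
Proof.
rewrite dlt_x mulr2n; apply: rationalD; last exact: rational_poly.
by apply: rationalD; exact: rational_y.
Qed.

Lemma rational_dlt_poly p : rational_fun (dlt (fpoly CK p^i)).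
Proof.
rewrite dlt_poly deriv_map -dlt_x.
by apply: rationalM; [exact: rational_poly | exact: rational_dlt_x].
Qed.

(** [dlt x] and [dlt y] have coefficients in [F]; in general [dlt e] is found by differentiating
    [e c = a + b y]. *)
Lemma rational_dlt (e : funfield CK) : rational_fun e -> rational_fun (dlt e).
Proof.
move=> re; have [a [b [c [c0 eE]]]] := re; rewrite !base_polyE in eE.
have fc0 : fpoly CK c^i != 0 by rewrite fpoly_eq0 map_poly_eq0.
have ecE : e * fpoly CK c^i = fpoly CK a^i + fpoly CK b^i * fy CK by rewrite eE
  divfK.
have := congr1 (@dlt K g CK) ecE; rewrite (dltM e) dltD (dltM (fpoly CK b^i))
  => E1.
have -> : dlt e = (dlt (fpoly CK a^i) + (dlt (fpoly CK b^i) * fy CK + fpoly CK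
  b^i * dlt (fy CK))
    - e * dlt (fpoly CK c^i)) / fpoly CK c^i.
  by apply: (canRL (mulfK fc0)); rewrite -E1 addrK.
apply: rationalM; last by apply: rationalV; exact: rational_poly.
apply: rationalD; last first.
  by apply: rationalN; apply: rationalM => //; exact: rational_dlt_poly.
apply: rationalD; first exact: rational_dlt_poly.
apply: rationalD; apply: rationalM.
- exact: rational_dlt_poly.
- exact: rational_y.
- exact: rational_poly.
rewrite dlt_y !deriv_map; apply: rationalD; first exact: rational_poly.
by apply: rationalN; apply: rationalM; [exact: rational_poly | exact:
  rational_y].
Qed.

End RationalFunctions.

Lemma mulr_boolr (R : nzRingType) (x : R) (b : bool) : x * b%:R = if b then x
  else 0.
Proof. by case: b; rewrite ?mulr1 ?mulr0. Qed.

(** The left-hand side is the derivative of [v^2 + h v - f] at [x], arranged by the two partial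
    derivatives of the curve equation at [(x, v(x))]. *)
Lemma double_root_tangent (R : fieldType) (v h f : {poly R}) x :
    ('X - x%:P) ^+ 2 %| v ^+ 2 + h * v - f ->
  v^`().[x] * (2%:R * v.[x] + h.[x]) + (h^`().[x] * v.[x] - f^`().[x]) = 0.
Proof.
case/dvdpP => q /(congr1 (fun r : {poly R} => r^`().[x])).
rewrite !expr2 mulrA derivM derivXsubC derivB derivD !derivM.
rewrite mulr1 !(hornerXsubC, hornerD, hornerN, hornerM) subrr !mulr0 add0r =>
  E0.
rewrite -E0; ring.
Qed.

(** * Coefficients of the divisor of a Mumford pair *)

Section MumfordDivisor.
Variables (F : fieldType) (K : closedFieldType) (iota : {rmorphism F -> K}).
Variables (g : nat) (C : imaginary_model F g).
Local Notation CK := (base_change iota C).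
Local Notation "p ^i" := (map_poly iota p) (at level 2, format "p ^i").
Variables (u v : {poly F}).
Hypothesis uv : mumford_pair C u v.
Let D := mumford_div iota C u v.

Lemma mumford_neq0 : u^i != 0.
Proof. by rewrite map_poly_eq0 monic_neq0 //; case: uv. Qed.

Lemma mem_roots x :
  (x \in undup (sval (closed_field_poly_normal u^i))) = root u^i x.
Proof.
case: closed_field_poly_normal => s /= sE; rewrite mem_undup sE.
by rewrite rootZ ?root_prod_XsubC // lead_coef_eq0 mumford_neq0.
Qed.

Lemma mumford_dvd_map : u^i %| v^i ^+ 2 + hpol CK * v^i - fpol CK.
Proof.
case: uv => _ _; rewrite -(dvdp_map iota).
by rewrite rmorphB rmorphD rmorphXn rmorphM.
Qed.

Lemma mumford_onC x : root u^i x ->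
  v^i.[x] ^+ 2 + (hpol CK).[x] * v^i.[x] == (fpol CK).[x].
Proof.
move=> ux; have : root (v^i ^+ 2 + hpol CK * v^i - fpol CK) x.
  by have /dvdpP[q ->] := mumford_dvd_map; rewrite rootM ux orbT.
by rewrite /root !hornerE subr_eq0.
Qed.

Lemma mkpoint_eq x y (p : affine_point CK) :
  (mkpoint iota C x y == Some p :> point CK) = ((x, y) == val p).
Proof.
rewrite /mkpoint; case: insubP => [q _ qE|onC].
  by rewrite -qE; apply/eqP/eqP => [[->]|/val_inj->].
by apply/eqP/eqP => // xy; rewrite xy (valP p) in onC.
Qed.

(** Only the summand at the abscissa of [p] can contribute; if that is no root of [u], its
    multiplicity is [0] anyway. *)
Lemma coeff_mumford (p : affine_point CK) : coeff (Some p : point CK) D =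
  if (val p).2 == v^i.[(val p).1] then (mup (val p).1 u^i)%:Z else 0.
Proof.
rewrite /D /mumford_div raddf_sum /=.
under eq_bigr => x _ do rewrite coeffU mkpoint_eq mulr_boolr.
have [pv|pv] := eqVneq; last first.
  rewrite big1_seq // => x _; case: eqP => // xp.
  by rewrite -xp /= eqxx in pv.
have [pu|pu] := boolP (root u^i (val p).1); last first.
  rewrite (mupNroot pu) big1_seq // => x /andP[_ xs]; case: eqP => // xp.
  by rewrite mem_roots in xs; rewrite -xp /= xs in pu.
rewrite (bigD1_seq (val p).1) ?undup_uniq ?mem_roots //=.
have -> : ((val p).1, v^i.[(val p).1]) == val p by rewrite -pv
  -surjective_pairing.
rewrite big1 ?addr0 // => x xp; case: eqP => // xE.
by rewrite -xE /= eqxx in xp.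
Qed.

(** All points in the sum lie on the curve, so the default value [pinf] of [mkpoint] does not
    occur. *)
Lemma coeff_mumford_pinf : coeff (pinf CK) D = 0.
Proof.
rewrite /D /mumford_div raddf_sum /= big1_seq // => x /andP[_ xs].
rewrite mem_roots in xs; rewrite coeffU /mkpoint.
by case: insubP => [q _ _|]; rewrite ?mulr0 // mumford_onC.
Qed.

(** Where [2y + h = 0], a double root of [u] would make the other partial derivative vanish too, by
    [double_root_tangent]. *)
Lemma mumford_ramified_simple (p : affine_point CK) : nonsingular CK ->
    2%:R * (val p).2 + (hpol CK).[(val p).1] = 0 -> (val p).2 = v^i.[(val p).1]
      ->
  (mup (val p).1 u^i <= 1)%N.
Proof.
move=> ns ram pv; rewrite mup_leq ?mumford_neq0 //; apply/negP => dv.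
apply: (nonsingularP ns (p := p)); split=> //.
have := double_root_tangent (dvdp_trans dv mumford_dvd_map).
by rewrite -pv ram mulr0 add0r.
Qed.

End MumfordDivisor.

(** * Canonical divisors and the criterion *)

Section CanonicalDivisor.
Variables (F : fieldType) (K : closedFieldType) (iota : {rmorphism F -> K}).
Variables (g : nat) (C : imaginary_model F g).
Local Notation CK := (base_change iota C).
Hypothesis ns : nonsingular CK.
Hypothesis g_gt0 : (0 < g)%N.

Definition canonical_inf : divisor CK := << (g.-1.*2)%:Z *g pinf CK >>.

Lemma coeff_pinf_affine (n : int) (p : affine_point CK) :
  coeff (Some p : point CK) << n *g pinf CK >> = 0.
Proof. by rewrite coeffU mulr0. Qed.

Lemma coeff_pinf_pinf (n : int) : coeff (pinf CK) << n *g pinf CK >> = n.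
Proof. by rewrite coeffU mulr1. Qed.

Lemma is_ord_dlt_canonical (P : point CK) t : uniformizer P t ->
  is_ord P (dlt t) (- coeff P canonical_inf).
Proof.
move=> Ut; have := is_ord_dlt ns g_gt0 Ut; case: P {Ut} => [p|].
  by rewrite coeff_pinf_affine oppr0.
by rewrite -[X in coeff X _]/(pinf CK) coeff_pinf_pinf.
Qed.

Lemma dlt_derivation_scaled (c : funfield CK) : derivation (fun e => dlt e / c).
Proof.
split=> [a b|a b|c'].
- by rewrite dltD mulrDl.
- by rewrite dltM mulrDl mulrAC mulrA.
- by rewrite dlt_const mul0r.
Qed.

(** The differential is [dx / (2y + h)], since [dlt x = 2y + h]. As [d/dt] is [dlt / dlt t], its
    order is minus that of [dlt t]. *)
Lemma canonical_infP : canonical_div canonical_inf.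
Proof.
exists (dlt (fx CK))^-1, (fx CK); split.
- by apply: rationalV; exact: rational_dlt_x.
- exact: rational_x.
move=> P; have [t Ut] := uniformizer_exists ns P.
have ot := is_ord_dlt_canonical Ut; have t0 := is_ord_neq0 ns ot.
exists t, (fun e => dlt e / dlt t); split=> //.
- exact: dlt_derivation_scaled.
- exact: divff.
rewrite mulKf ?(dlt_x_neq0 ns g_gt0) //.
by have := is_ordV ns ot; rewrite opprK.
Qed.

(** The function [phi * dlt psi] is the quotient of [phi dpsi] by [dx / (2y + h)], because
    [dlt psi = d psi * dlt t]. *)
Lemma is_ord_diff_dlt (P : point CK) (phi psi : funfield CK) n :
  is_ord_diff P phi psi n -> is_ord P (phi * dlt psi) (n - coeff P
    canonical_inf).
Proof.
case=> t [d [Ut [dD dM dC] dt on]].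
have ot := is_ord_dlt_canonical Ut.
have dE := derivation_delta (fxy_curve CK) (fxy_free (C := CK)) (fxy_gen (C :=
  CK)) dD dM dC.
have E1 : dlt (fx CK) = d (fx CK) * dlt t by rewrite -(dE t) dt mul1r.
have dx0 : d (fx CK) != 0.
  by have := dlt_x_neq0 ns g_gt0; rewrite E1 mulf_eq0 negb_or => /andP[].
have -> : dlt psi = d psi * dlt t.
  by apply: (mulfI dx0); rewrite -(dE psi) -/(dlt (fx CK)) E1 mulrCA mulrA.
by rewrite mulrA; exact: (is_ordM ns on ot).
Qed.

End CanonicalDivisor.

(** * The two implications of the criterion *)

Section Main.
Variables (F : fieldType) (K : closedFieldType) (iota : {rmorphism F -> K}).
Variables (g : nat) (C : imaginary_model F g).
Local Notation CK := (base_change iota C).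
Local Notation "p ^i" := (map_poly iota p) (at level 2, format "p ^i").
Hypothesis ns : nonsingular CK.
Hypothesis g_gt0 : (0 < g)%N.
Variables (u v : {poly F}).
Hypothesis uv : mumford_pair C u v.
Local Notation D := (mumford_div iota C u v).
Local Notation m := (size u).-1.
Let u0 : u != 0. Proof. by rewrite monic_neq0 //; case: uv. Qed.

Lemma mumford_effective (p : affine_point CK) : 0 <= coeff (Some p : point CK)
  D.
Proof. by rewrite coeff_mumford //; case: ifP. Qed.

Lemma is_ord_mumford_u (p : affine_point CK) :
  exists2 n, is_ord (Some p) (fpoly CK u^i) n & coeff (Some p : point CK) D <=
    n.
Proof.
have [n on le_n] := is_ord_ge_mup ns p (mumford_neq0 iota uv).
exists n => //; rewrite coeff_mumford //; case: ifP => // _.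
by apply: le_trans le_n.
Qed.

(** At unramified points the order of [q] is the multiplicity of its root. At ramified points orders
    are larger than multiplicities, but there [u] has only a simple root and [q] vanishes. *)
Lemma size_mumford_le (q : {poly K}) : q != 0 ->
    (forall p : affine_point CK, exists2 n, is_ord (Some p) (fpoly CK q) n
       & coeff (Some p : point CK) D <= n) ->
  (size u <= size q)%N.
Proof.
move=> q0 ordq; rewrite -(size_map_poly iota u).
apply: size_le_of_mup => // [|x]; first exact: mumford_neq0 uv.
have [ux|/mupNroot-> //] := boolP (root u^i x).
pose p : affine_point CK := Sub (x, v^i.[x]) (mumford_onC uv ux).
have [n on] := ordq p; rewrite coeff_mumford // SubK eqxx /= => le_n.
have [ram|unr] := eqVneq (2%:R * (val p).2 + (hpol CK).[(val p).1]) 0.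
  have := mumford_ramified_simple uv ns ram; rewrite SubK /= => /(_ erefl) mu1.
  have mu_gt0 : (0 < mup x u^i)%N by rewrite -XsubC_dvd ?dvdp_XsubCl //
    (mumford_neq0 iota uv).
  rewrite (leq_trans mu1) // -XsubC_dvd // dvdp_XsubCl.
  have n_gt0 : 0 < n by lia.
  have := value_at_uniq ns (value_at_poly p q) (is_ord_zero ns on n_gt0).
  by rewrite SubK => /eqP.
have := is_ord_uniq ns on (is_ord_mup ns q0 unr); rewrite SubK => nE.
by rewrite -lez_nat (le_trans le_n) // nE.
Qed.

Variables (A : divisor CK) (phi0 : funfield CK).
Hypothesis phi0_rational : rational_fun phi0.
Hypothesis phi0_div : forall P, is_ord P phi0
  (coeff P (A - << (g%:Z - 1) *g pinf CK >> - (D - << m%:Z *g pinf CK >>))).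

Lemma phi0_affine (p : affine_point CK) :
  is_ord (Some p) phi0 (coeff (Some p : point CK) A - coeff (Some p : point CK)
    D).
Proof.
by have := phi0_div (Some p); rewrite !coeffB !coeff_pinf_affine !subr0.
Qed.

Lemma phi0_inf : is_ord (pinf CK) phi0 (coeff (pinf CK) A - (g%:Z - 1) + m%:Z).
Proof.
by have := phi0_div (pinf CK); rewrite !coeffB !coeff_pinf_pinf
  coeff_mumford_pinf // sub0r opprK.
Qed.

Let phi00 : phi0 != 0. Proof. exact: (is_ord_neq0 ns phi0_inf). Qed.

Lemma nonspecial_of_size : m = g -> nonspecial A.
Proof.
move=> mg; exists (canonical_inf iota C); first exact: canonical_infP.
have only0 phi : riemann_roch_space (canonical_inf iota C - A) phi -> phi = 0.
  move=> [_ [//|ord_phi]]; apply/eqP; apply/negP => /negP phi_neq0.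
  have reg (p : affine_point CK) : exists2 n, is_ord (Some p) (phi / phi0) n
      & coeff (Some p : point CK) D <= n.
    have [n on] := ord_phi (Some p); rewrite coeffB coeff_pinf_affine => le_n.
    by eexists; [exact: (is_ordM ns on (is_ordV ns (phi0_affine p))) | lia].
  have areg : affine_regular (phi / phi0).
    move=> p; have [n on le_n] := reg p.
    apply: is_ord_regular ns _ _ _ on _; apply: le_trans le_n;
      exact: mumford_effective.
  have [a [b E1]] := affine_regularP ns areg.
  have e0 : phi / phi0 != 0 by rewrite mulf_neq0 ?invr_eq0.
  have [n on] := ord_phi (pinf CK); rewrite coeffB coeff_pinf_pinf => le_n.
  have oe := is_ordM ns on (is_ordV ns phi0_inf).
  (* The order at infinity is at least [-(g-1) - m = -(2g-1)], which excludes a term in [y]. *)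
  have b0 : b = 0.
    rewrite E1 in e0 oe; apply: (inf_order_linear ns e0 oe); lia.
  rewrite b0 fpoly0 mul0r addr0 in E1; rewrite E1 in e0 oe reg.
  have a0 : a != 0 by rewrite fpoly_eq0 in e0.
  (* Now [deg a >= m = g] forces a pole of order at least [2g] at infinity, one more than
     allowed. *)
  have := size_mumford_le a0 reg.
  have := is_ord_uniq ns oe (is_ord_inf_poly ns a0).
  move: mg g_gt0 le_n; clear; move: (coeff _ A) (size u) (size a) => cA su sa;
    lia.
(* The basis is indexed by the empty type ['I_0], so the function given here is arbitrary. *)
exists (fun=> 0); split=> [phi|c _]; last by apply/rowP => -[].
split=> [/only0->|[c ->]]; first by exists 0; rewrite big_ord0.
rewrite big_ord0; split; last by left.
by have := rational_poly iota C 0; rewrite rmorph0 fpoly0.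
Qed.

Lemma size_of_nonspecial : (m <= g)%N -> nonspecial A -> m = g.
Proof.
move=> le_mg [W [phi [psi [rphi rpsi diffW]]] [e [eV _]]].
apply/eqP; rewrite eqn_leq le_mg leqNgt; apply/negP => lt_mg.
pose r := phi * dlt psi.
have or P : is_ord P r (coeff P W - coeff P (canonical_inf iota C)).
  by apply: is_ord_diff_dlt.
have r0 : r != 0 := is_ord_neq0 ns (or (pinf CK)).
(* A nonzero element of [L(W - A)] if [m < g]: dividing by [r] passes from [(2g-2) Pinf] to [W], and
   the order at infinity is the required bound plus [g-1-m]. *)
pose theta := fpoly CK u^i * phi0 / r.
have [+ _] := eV theta; case.
  split; first apply: rationalM.
  - by apply: rationalM => //; exact: rational_poly.
  - by apply: rationalV; apply: rationalM => //; exact: rational_dlt.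
  right=> -[p|].
    have [n on le_n] := is_ord_mumford_u p.
    eexists; first exact: (is_ordM ns (is_ordM ns on (phi0_affine p)) (is_ordV
      ns (or (Some p)))).
    rewrite coeffB coeff_pinf_affine; lia.
  have ou := is_ord_inf_poly ns (mumford_neq0 iota uv).
  eexists; first exact: (is_ordM ns (is_ordM ns ou phi0_inf) (is_ordV ns (or
    (pinf CK)))).
  rewrite -[X in coeff X _]/(pinf CK) coeffB coeff_pinf_pinf size_map_poly; lia.
move=> c; rewrite big_ord0 => /eqP; apply/negP.
by rewrite !mulf_neq0 ?invr_eq0 // fpoly_eq0 (mumford_neq0 iota uv).
Qed.

End Main.

Theorem corollary1 (F : finFieldType) (K : closedFieldType)
    (iota : {rmorphism F -> K}) (K_algebraic : integralRange iota)
    (g : nat) (g_ge2 : (2 <= g)%N) (C : imaginary_model F g)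
    (C_nonsingular : nonsingular (base_change iota C))
    (A : divisor (base_change iota C)) (A_rational : rational_div A)
    (degA : deg A = g%:Z - 1) (uA vA : {poly F})
    (uvA : reduced_mumford_rep uA vA
             (A - << (g%:Z - 1) *g pinf (base_change iota C) >>)) :
  nonspecial A <-> (size uA).-1 = g.
Proof.
have g_gt0 : (0 < g)%N by apply: leq_trans g_ge2.
case: uvA => uv le_mg [phi0 rphi0 dphi0]; split.
  exact: (size_of_nonspecial C_nonsingular g_gt0 uv rphi0 dphi0).
exact: (nonspecial_of_size C_nonsingular g_gt0 uv dphi0).
Qed.
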